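(* Consider the SPDHG iterates described in the context, and for $K\ge1$ let $x^K_{av}=\frac1K\sum_{k=1}^K x^k$ and $y^{K+1}_{av}=\frac1K\sum_{k=1}^K y^{k+1}$. Let $(x^\star,y^\star)\in\mathcal{Z}^\star$ and $\Delta^0=V_1(x^0-x^\star,y^1-y^\star)$. Then for any set $\mathcal{B}=\mathcal{B}_x\times\mathcal{B}_y\subseteq\mathcal{Z}$, the expected restricted primal-dual gap satisfies $$\mathbb{E}\left[G_{\mathcal{B}}(x^K_{av},y^{K+1}_{av})\right]=\mathbb{E}\left[\sup_{(x,y)\in\mathcal{B}}\mathcal{H}(x^K_{av},y^{K+1}_{av};x,y)\right]\le\frac{C_{\mathcal{B}}}{K},$$ where $$\begin{aligned}C_{\mathcal{B}}={}&\frac{1+2c}{2}\sup_{x\in\mathcal{B}_x}\|x^0-x\|^2_{\tau^{-1}}+\sup_{y\in\mathcal{B}_y}\|y^1-y\|^2_{\sigma^{-1}P^{-1}}+f^\ast_{P^{-1}-I}(y^1)-f^\ast_{P^{-1}-I}(y^\star)\\&+\Big(\frac1{C_1}+2c+c_1\Big)\Delta^0+c\|x^0\|^2_{\tau^{-1}}+c\|y^1-y^\star\|^2_{\sigma^{-1}P^{-1}}+\frac{\|\sigma^{1/2}A\tau^{1/2}\|^2}{2c_1\underline p}\|x^\star\|^2_{\tau^{-1}},\end{aligned}$$ with $c_1=\|\tau^{1/2}A^\top\sigma^{1/2}P^{-1/2}\|$, $c=\|\tau^{1/2}A^\top(P^{-1}-I)\sigma^{1/2}P^{1/2}\|$, $C_1=1-\gamma$,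 $\underline p=\min_ip_i$.
   Context: **Problem.** $\mathcal{X},\mathcal{Y}_1,\dots,\mathcal{Y}_n$ are Euclidean spaces, $\mathcal{Y}=\prod_{i=1}^n\mathcal{Y}_i$, $\mathcal{Z}=\mathcal{X}\times\mathcal{Y}$, $z=(x,y)$. $A_i:\mathcal{X}\to\mathcal{Y}_i$ are linear, $Ax=(A_1x,\dots,A_nx)$, $A^\top$ is the adjoint of $A$. The problem is $\min_{x\in\mathcal{X}}\sum_{i=1}^n f_i(A_ix)+g(x)$, with $f(y)=\sum_i f_i(y_i)$. Standing assumptions: $f_i:\mathcal{Y}_i\to\mathbb{R}\cup\{+\infty\}$ and $g:\mathcal{X}\to\mathbb{R}\cup\{+\infty\}$ are proper, lower semicontinuous, convex; the problem has at least one minimizer; and $0\in\mathrm{ri}(\mathrm{dom} f-A\,\mathrm{dom} g)$. $h^\ast$ is the Fenchel conjugate of $h$, so $f^\ast(y)=\sum_i f_i^\ast(y_i)$. $\mathcal{Z}^\star$ is the set of primal-dual solutions: $(x^\star,y^\star)\in\mathcal{Z}$ with $0\in A^\top y^\star+\partial g(x^\star)$ and $0\in Ax^\star-\partial f^\ast(y^\star)$. **Gap.** $\mathcal{H}(\bar x,\bar y;x,y)=g(\bar x)+\langle A\bar x,y\rangle-f^\ast(y)-g(x)-\langle Ax,\bar y\rangle+f^\ast(\bar y)$, taken to be $-\infty$ when $x\notin\mathrm{dom}\,g$ or $y\notin\mathrm{dom} f^\ast$; $G_{\mathcal{B}}(\bar x,\bar y)=\sup_{(x,y)\in\mathcal{B}}\mathcal{H}(\bar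 x,\bar y;x,y)$. The constant $C_{\mathcal{B}}$ may be $+\infty$ (e.g. if $\mathcal{B}$ is unbounded), in which case the bound is vacuous. **Norms and weights.** For $\tau>0$, $\|x\|^2_{\tau^{-1}}=\tau^{-1}\|x\|^2$. For positive weights $w_1,\dots,w_n$, $\|y\|_w^2=\sum_i w_i\|y_i\|^2$; $\sigma^{-1}P^{-1}$ denotes the weights $\sigma_i^{-1}p_i^{-1}$. In operator expressions, $P^{a}$ and $\sigma^{a}$ act on $\mathcal{Y}$ blockwise, multiplying block $i$ by $p_i^a$, resp. $\sigma_i^a$, $\tau^{1/2}$ is a scalar, and $\|\cdot\|$ is the Euclidean operator norm. $f^\ast_{P^{-1}-I}(y)=\sum_{i=1}^n(p_i^{-1}-1)f_i^\ast(y_i)$. **Algorithm (SPDHG).** Probabilities $p_i>0$, $\sum_i p_i=1$; step sizes $\tau>0$, $\sigma_i>0$ satisfying $p_i^{-1}\tau\sigma_i\|A_i\|^2\le\gamma^2<1$ for all $i$, for some $\gamma\in[0,1)$. $\mathrm{prox}_{t,h}(x)=\arg\min_u h(u)+\frac{1}{2t}\|u-x\|^2$. Start from deterministic $x^0\in\mathcal{X}$, $y^0=y^1=\bar y^1\in\mathcal{Y}$. For $k=1,2,\dots$: $x^k=\mathrm{prox}_{\tau,g}(x^{k-1}-\tau A^\top\bar y^k)$; draw $i_k\in\{1,\dots,n\}$ independently of the past with $\Pr(i_k=i)=p_i$; $y^{k+1}_{i_k}=\mathrm{prox}_{\sigma_{i_k},f^\ast_{i_k}}(y^k_{i_k}+\sigma_{i_k}A_{i_k}x^k)$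 and $y^{k+1}_i=y^k_i$ for $i\ne i_k$; $\bar y^{k+1}=y^{k+1}+P^{-1}(y^{k+1}-y^k)$. **Function $V_1$.** Since $y^1=y^0$, $V_1(x,y)=\tfrac12\|x\|^2_{\tau^{-1}}+\tfrac12\|y\|^2_{\sigma^{-1}P^{-1}}$. *)

(* Defs.v *)
From HB Require Import structures.
From mathcomp Require Import all_boot all_order all_algebra.
From mathcomp Require Import all_classical all_reals all_analysis.

Set Implicit Arguments.
Unset Strict Implicit.
Unset Printing Implicit Defensive.

Import Order.TTheory GRing.Theory Num.Theory.
Import numFieldNormedType.Exports.

Local Open Scope classical_set_scope.
Local Open Scope ring_scope.

(* The norm that MathComp-Analysis puts on matrices is the sup norm; the
   Euclidean norms are therefore introduced here.  (Both induce the topology of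
   'cV[R]_N, so the library's [lower_semicontinuous] is the usual one.) *)
Section Euclidean.
Context {R : realType}.

Definition dot N (u v : 'cV[R]_N) : R := \sum_i u i 0 * v i 0.

Definition enorm N (u : 'cV[R]_N) : R := Num.sqrt (dot u u).

Definition opnorm M N (B : 'M[R]_(M, N)) : R :=
  sup [set enorm (B *m u) | u in [set u : 'cV[R]_N | enorm u <= 1]].

End Euclidean.

Section ConvexAnalysis.
Context {R : realType} {N : nat}.
Implicit Types (h : 'cV[R]_N -> \bar R) (S : set 'cV[R]_N).

Definition edom h : set 'cV[R]_N := [set x | (h x < +oo)%E].

Definition proper_fun h : Prop :=
  (forall x, (-oo < h x)%E) /\ edom h !=set0.

Definition convex_efun h : Prop :=
  forall (x y : 'cV[R]_N) (t : R), 0 < t < 1 ->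
    (h (t *: x + (1 - t) *: y)%R <= t%:E * h x + (1 - t)%:E * h y)%E.

Definition proper_lsc_convex h : Prop :=
  [/\ proper_fun h, lower_semicontinuous h & convex_efun h].

Definition fenchel h (v : 'cV[R]_N) : \bar R :=
  ereal_sup [set ((dot u v)%:E - h u)%E | u in [set: 'cV[R]_N]].

(* If [h] is proper and [h x = +oo], this set is empty. *)
Definition subdiff h (x : 'cV[R]_N) : set 'cV[R]_N :=
  [set v | forall u, (h x + (dot v (u - x))%:E <= h u)%E].

(* The set of minimizers; it is a singleton when [h] is proper, lower
   semicontinuous and convex and [0 < t], so that [prox t h x u] then says
   that u is the proximal point of x. *)
Definition prox (t : R) h (x : 'cV[R]_N) : set 'cV[R]_N :=
  [set u | forall v, (h u + (1 / (2 * t) * enorm (u - x) ^+ 2)%:E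
                      <= h v + (1 / (2 * t) * enorm (v - x) ^+ 2)%:E)%E].

Definition affine_hull S : set 'cV[R]_N :=
  [set x | exists k (a : 'I_k -> R) (s : 'I_k -> 'cV[R]_N),
    [/\ forall j, S (s j), \sum_j a j = 1 & x = \sum_j a j *: s j]].

Definition rel_interior S : set 'cV[R]_N :=
  [set x | affine_hull S x /\ exists2 e : R, 0 < e &
    forall y, affine_hull S y -> enorm (y - x) < e -> S y].

End ConvexAnalysis.

(* The product space Y_1 x ... x Y_n is the space of block columns: the i-th
   component of [y : 'cV_(\sum_i m i)] is [submxcol y i]. *)
Section Blocks.
Context {R : realType} {n : nat} {m : 'I_n -> nat}.

Definition blockdiag (a : 'I_n -> R) : 'M[R]_(\sum_i m i) :=
  \mxdiag_(i < n) (a i)%:M.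

Definition wnorm2 (w : 'I_n -> R) (y : 'cV[R]_(\sum_i m i)) : R :=
  \sum_i w i * enorm (submxcol y i) ^+ 2.

Definition sepsum (f : forall i, 'cV[R]_(m i) -> \bar R)
    (y : 'cV[R]_(\sum_i m i)) : \bar R :=
  (\sum_i f i (submxcol y i))%E.

(* the function f^*_{P^{-1}-I} *)
Definition wfenchel (p : 'I_n -> R) (f : forall i, 'cV[R]_(m i) -> \bar R)
    (y : 'cV[R]_(\sum_i m i)) : \bar R :=
  (\sum_i ((p i)^-1 - 1)%:E * fenchel (f i) (submxcol y i))%E.

End Blocks.

Section PrimalDual.
Context {R : realType} {d N : nat}.
Variables (f : 'cV[R]_N -> \bar R) (g : 'cV[R]_d -> \bar R).
Variable A : 'M[R]_(N, d).

Definition objective (x : 'cV[R]_d) : \bar R := (f (A *m x) + g x)%E.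

Definition qualification : Prop :=
  rel_interior [set v - A *m x | v in edom f & x in edom g] 0.

Definition saddle_set : set ('cV[R]_d * 'cV[R]_N) :=
  [set z | subdiff g z.1 (- (A^T *m z.2)) /\
           subdiff (fenchel f) z.2 (A *m z.1)].

Definition Hgap (zb z : 'cV[R]_d * 'cV[R]_N) : \bar R :=
  (if (g z.1 < +oo) && (fenchel f z.2 < +oo) then
     g zb.1 + (dot (A *m zb.1) z.2)%:E - fenchel f z.2
     - g z.1 - (dot (A *m z.1) zb.2)%:E + fenchel f zb.2
   else -oo)%E.

Definition restricted_gap (B : set ('cV[R]_d * 'cV[R]_N))
    (zb : 'cV[R]_d * 'cV[R]_N) : \bar R :=
  ereal_sup [set Hgap zb z | z in B].

End PrimalDual.

Section SPDHG.
Context {R : realType} {d n : nat} {m : 'I_n -> nat}.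
Variables (f : forall i, 'cV[R]_(m i) -> \bar R) (g : 'cV[R]_d -> \bar R).
Arguments f : clear implicits.
Variable A_ : forall i, 'M[R]_(m i, d).
Variables (p sigma : 'I_n -> R) (tau : R).

Let A : 'M[R]_(\sum_i m i, d) := \mxcol_i A_ i.

(* One trajectory of the algorithm, driven by the indices i_1, i_2, ...
   The values [idx 0] and [ybar 0] are not used. *)
Record spdhg (x0 : 'cV[R]_d) (y1 : 'cV[R]_(\sum_i m i)) (idx : nat -> 'I_n)
    (x : nat -> 'cV[R]_d) (y ybar : nat -> 'cV[R]_(\sum_i m i)) : Prop := {
  spdhg_x0 : x 0%N = x0 ;
  spdhg_y0 : y 0%N = y1 ;
  spdhg_y1 : y 1%N = y1 ;
  spdhg_ybar1 : ybar 1%N = y1 ;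
  spdhg_x : forall k, (0 < k)%N ->
    prox tau g (x k.-1 - tau *: (A^T *m ybar k)) (x k) ;
  spdhg_y_drawn : forall k, (0 < k)%N ->
    prox (sigma (idx k)) (fenchel (f (idx k)))
      (submxcol (y k) (idx k) + sigma (idx k) *: (A_ (idx k) *m x k))
      (submxcol (y k.+1) (idx k)) ;
  spdhg_y_kept : forall k i, (0 < k)%N -> i != idx k ->
    submxcol (y k.+1) i = submxcol (y k) i ;
  spdhg_ybar : forall k, (0 < k)%N ->
    ybar k.+1 = y k.+1 + blockdiag (fun i => (p i)^-1) *m (y k.+1 - y k) }.

Definition dual_weights (i : 'I_n) : R := (sigma i)^-1 * (p i)^-1.

Definition xnorm2 (x : 'cV[R]_d) : R := tau^-1 * enorm x ^+ 2.

Definition V1 (x : 'cV[R]_d) (y : 'cV[R]_(\sum_i m i)) : R :=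
  1 / 2 * xnorm2 x + 1 / 2 * wnorm2 dual_weights y.

Definition cst_c1 : R :=
  opnorm (Num.sqrt tau *: (A^T *m blockdiag (fun i => Num.sqrt (sigma i))
                               *m blockdiag (fun i => (Num.sqrt (p i))^-1))).

Definition cst_c : R :=
  opnorm (Num.sqrt tau *: (A^T *m (blockdiag (fun i => (p i)^-1) - 1%:M)
                               *m blockdiag (fun i => Num.sqrt (sigma i))
                               *m blockdiag (fun i => Num.sqrt (p i)))).

Definition cst_A : R :=
  opnorm (blockdiag (fun i => Num.sqrt (sigma i)) *m A *m (Num.sqrt tau)%:M).

(* min_i p_i: the default value 1 is harmless since p_i <= 1. *)
Definition pmin : R := \big[Num.min/1]_i p i.

(* If A = 0, then [cst_c1 = cst_A = 0] and the last term is 0. *)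
Definition C_B (gamma : R) (Bx : set 'cV[R]_d) (By : set 'cV[R]_(\sum_i m i))
    (x0 xs : 'cV[R]_d) (y1 ys : 'cV[R]_(\sum_i m i)) : \bar R :=
  let c := cst_c in let c1 := cst_c1 in let C1 := 1 - gamma in
  let Delta0 := V1 (x0 - xs) (y1 - ys) in
  (((1 + 2 * c) / 2)%:E * ereal_sup [set (xnorm2 (x0 - x)%R)%:E | x in Bx]
   + ereal_sup [set (wnorm2 dual_weights (y1 - y)%R)%:E | y in By]
   + wfenchel p f y1 - wfenchel p f ys
   + ((1 / C1 + 2 * c + c1) * Delta0 + c * xnorm2 x0
      + c * wnorm2 dual_weights (y1 - ys)
      + cst_A ^+ 2 / (2 * c1 * pmin) * xnorm2 xs)%:E)%E.

End SPDHG.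

(* i_1, i_2, ... are random indices with law p, each of them independent of the
   history (i_1, ..., i_(k-1)), i.e. of every event determined by it. *)
Record random_draws {R : realType} (dsp : measure_display)
    (Omega : measurableType dsp) (P : probability Omega R) (n : nat)
    (p : 'I_n -> R) (idx : nat -> Omega -> 'I_n) : Prop := {
  draws_measurable : forall k i, (0 < k)%N ->
    measurable [set w | idx k w = i] ;
  draws_law : forall k i, (0 < k)%N -> P [set w | idx k w = i] = (p i)%:E ;
  draws_indep : forall k i (S : set (seq 'I_n)), (0 < k)%N ->
    let past := [set w | S [seq idx l w | l <- iota 1 k.-1]] in
    (P (past `&` [set w | idx k w = i]) = P past * P [set w | idx k w = i])%E }.

(* Main.v *)
(* Adding the three-point inequalities of the two proximal steps bounds one gap
   increment by the decrease of a potential (the distances to the comparison point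
   (x, y), a cross term with the last dual increment, and the square of that
   increment), plus terms that are centred given the past, plus two telescoping
   terms: <Ax, (P^-1 - I)(y^(k+1) - y^k)>, and the increments of f^*_{P^-1 - I}
   coming from the fact that only one block moves.  The step size condition, through
   Young's inequality, makes the potential nonnegative.

   The centred terms depend on (x, y) only through <y, U>, where U is the accumulated
   noise, so the supremum can be taken before the expectation: Young's inequality
   gives |y^1 - y|^2/2 + |U|^2/2, and the second term is, in mean, at most the sum of
   the squared dual increments.  That sum, and |y^(K+1) - y^*|^2, are controlled by
   the same potential estimate at the saddle point, where the gap is nonnegative.
   All this holds along every trajectory up to one martingale, which the expectation
   removes; as it depends on finitely many draws, this is a finite computation. *)

Require Import Defs.
From HB Require Import structures.
From mathcomp Require Import all_boot all_order all_algebra.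
From mathcomp Require Import all_classical all_reals all_analysis.
From mathcomp Require Import ring lra.

Set Implicit Arguments.
Unset Strict Implicit.
Unset Printing Implicit Defensive.

Import Order.TTheory GRing.Theory Num.Theory.
Import numFieldNormedType.Exports.

Local Open Scope classical_set_scope.
Local Open Scope ring_scope.

(** * Euclidean inner product, norm and operator norm *)

Section EuclideanTheory.
Context {R : realType}.
Implicit Types a b : R.

(** Transfers an inequality to another one with the same gap; the equality of gaps is left to [ring]
    or [field]. *)
Lemma ler_eq_sub (r s r' s' : R) : s - r = s' - r' -> r <= s -> r' <= s'.
Proof. by move=> E; rewrite -subr_ge0 E subr_ge0. Qed.

Lemma dotC N (u v : 'cV[R]_N) : dot u v = dot v u.
Proof. by apply: eq_bigr => i _; rewrite mulrC. Qed.

Lemma dotDl N (u v w : 'cV[R]_N) : dot (u + v) w = dot u w + dot v w.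
Proof. by rewrite /dot -big_split; apply: eq_bigr => i _; rewrite mxE mulrDl. Qed.

Lemma dotZl N a (u w : 'cV[R]_N) : dot (a *: u) w = a * dot u w.
Proof. by rewrite /dot mulr_sumr; apply: eq_bigr => i _; rewrite mxE mulrA. Qed.

Lemma dotNl N (u w : 'cV[R]_N) : dot (- u) w = - dot u w.
Proof. by rewrite -scaleN1r dotZl mulN1r. Qed.

Lemma dot0l N (w : 'cV[R]_N) : dot 0 w = 0.
Proof. by rewrite -(scale0r w) dotZl mul0r. Qed.

Lemma dotDr N (u v w : 'cV[R]_N) : dot w (u + v) = dot w u + dot w v.
Proof. by rewrite !(dotC w) dotDl. Qed.

Lemma dotZr N a (u w : 'cV[R]_N) : dot w (a *: u) = a * dot w u.
Proof. by rewrite !(dotC w) dotZl. Qed.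

Lemma dotNr N (u w : 'cV[R]_N) : dot w (- u) = - dot w u.
Proof. by rewrite !(dotC w) dotNl. Qed.

Lemma dot0r N (w : 'cV[R]_N) : dot w 0 = 0.
Proof. by rewrite dotC dot0l. Qed.

Definition dotE := (@dotDl, @dotDr, @dotNl, @dotNr, @dotZl, @dotZr).

Lemma dotNN N (u : 'cV[R]_N) : dot (- u) (- u) = dot u u.
Proof. by rewrite dotNl dotNr opprK. Qed.

Lemma dot_sumr N I (r : seq I) (P : pred I) (F : I -> 'cV[R]_N) u :
  dot u (\sum_(i <- r | P i) F i) = \sum_(i <- r | P i) dot u (F i).
Proof. exact: (big_morph _ (fun v w => dotDr v w u) (dot0r u)). Qed.

Lemma dot_suml N I (r : seq I) (P : pred I) (F : I -> 'cV[R]_N) u :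
  dot (\sum_(i <- r | P i) F i) u = \sum_(i <- r | P i) dot (F i) u.
Proof. by rewrite dotC dot_sumr; apply: eq_bigr => i _; rewrite dotC. Qed.

Lemma dot_mx N (u v : 'cV[R]_N) : dot u v = (u^T *m v) 0 0.
Proof. by rewrite mxE; apply: eq_bigr => i _; rewrite mxE. Qed.

Lemma dot_mulmx M N (B : 'M[R]_(M, N)) u v : dot (B *m u) v = dot u (B^T *m v).
Proof. by rewrite !dot_mx trmx_mul mulmxA. Qed.

Lemma dot_ge0 N (u : 'cV[R]_N) : 0 <= dot u u.
Proof. by apply: sumr_ge0 => i _; rewrite -expr2 sqr_ge0. Qed.

(** Parallelogram law: the two sides differ by the squared norm of [(u - v) - (v - w)]. *)
Lemma sqr_distD N (u v w : 'cV[R]_N) :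
  dot (u - w) (u - w) <= 2 * dot (u - v) (u - v) + 2 * dot (v - w) (v - w).
Proof.
have := dot_ge0 ((u - v) - (v - w)).
apply: ler_eq_sub; rewrite !dotE (dotC w v) (dotC w u) (dotC v u); ring.
Qed.

Lemma dot_eq0 N (u : 'cV[R]_N) : dot u u = 0 -> u = 0.
Proof.
move=> /eqP; rewrite psumr_eq0; last by move=> i _; rewrite -expr2 sqr_ge0.
move=> /allP u0; apply/colP => i; apply/eqP; rewrite mxE -sqrf_eq0 expr2.
exact: (implyP (u0 i (mem_index_enum i))).
Qed.

Lemma enorm2 N (u : 'cV[R]_N) : enorm u ^+ 2 = dot u u.
Proof. by rewrite sqr_sqrtr// dot_ge0. Qed.

Lemma enorm_ge0 N (u : 'cV[R]_N) : 0 <= enorm u.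
Proof. exact: sqrtr_ge0. Qed.

Lemma enormZ N a (u : 'cV[R]_N) : enorm (a *: u) = `|a| * enorm u.
Proof. by rewrite /enorm dotZl dotZr mulrA -expr2 sqrtrM ?sqr_ge0// sqrtr_sqr. Qed.

Lemma enorm_eq0 N (u : 'cV[R]_N) : enorm u = 0 -> u = 0.
Proof. by move=> u0; apply: dot_eq0; rewrite -enorm2 u0 expr0n. Qed.


Lemma cauchy_schwarz N (u v : 'cV[R]_N) : dot u v <= enorm u * enorm v.
Proof.
have [/enorm_eq0 ->|u0] := eqVneq (enorm u) 0.
  by rewrite dot0l mulr_ge0 ?enorm_ge0.
have [/enorm_eq0 ->|v0] := eqVneq (enorm v) 0.
  by rewrite dot0r mulr_ge0 ?enorm_ge0.
have uv_gt0 : 0 < enorm u * enorm v by rewrite mulr_gt0// lt_neqAle eq_sym ?u0 ?v0 enorm_ge0.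
have := dot_ge0 (enorm v *: u - enorm u *: v).
rewrite !dotE -!enorm2 (dotC v u) => h.
rewrite -(ler_pM2l uv_gt0) -subr_ge0 -(@pmulr_rge0 _ 2)//.
by apply: le_trans h _; rewrite le_eqVlt; apply/orP; left; apply/eqP; ring.
Qed.

Lemma norm_dot_le N (u v : 'cV[R]_N) : `|dot u v| <= enorm u * enorm v.
Proof.
rewrite ler_norml cauchy_schwarz andbT lerNl -dotNl.
by rewrite (le_trans (cauchy_schwarz _ _))// -scaleN1r enormZ normrN1 mul1r.
Qed.

Lemma young_mul (r s t : R) : 0 < t -> r * s <= r ^+ 2 / (2 * t) + t / 2 * s ^+ 2.
Proof.
move=> t0; rewrite -subr_ge0.
have -> : r ^+ 2 / (2 * t) + t / 2 * s ^+ 2 - r * s = (r - t * s) ^+ 2 / (2 * t).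
  by field; rewrite gt_eqF.
by rewrite divr_ge0 ?sqr_ge0// mulr_ge0// ltW.
Qed.

(** Cauchy-Schwarz on each row bounds the set by the Frobenius norm; boundedness is what makes the
    real [sup] in [opnorm] an actual least upper bound. *)
Lemma opnorm_has_sup M N (B : 'M[R]_(M, N)) :
  has_sup [set enorm (B *m u) | u in [set u : 'cV[R]_N | enorm u <= 1]].
Proof.
split.
  by exists (enorm (B *m (0 : 'cV[R]_N))), 0 => //=; rewrite /enorm dot0l sqrtr0.
exists (Num.sqrt (\sum_i enorm (row i B)^T ^+ 2)) => _ [u /= u1 <-].
apply: ler_wsqrtr; apply: ler_sum => i _.
have -> : (B *m u) i 0 = dot (row i B)^T u.
  by rewrite mxE; apply: eq_bigr => j _; rewrite !mxE.
have rB : 0 <= enorm (row i B)^T by exact: enorm_ge0.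
rewrite -expr2 -[leLHS]ger0_norm ?sqr_ge0// normrX ler_pXn2r ?nnegrE//.
by rewrite (le_trans (norm_dot_le _ _))// ler_piMr.
Qed.

Lemma opnorm_ge0 M N (B : 'M[R]_(M, N)) : 0 <= opnorm B.
Proof.
apply: (@le_trans _ _ (enorm (B *m (0 : 'cV[R]_N)))); first exact: enorm_ge0.
by apply: (sup_upper_bound (opnorm_has_sup B)); exists 0 => //=; rewrite /enorm dot0l sqrtr0.
Qed.

Lemma enorm_mulmx_le M N (B : 'M[R]_(M, N)) u : enorm (B *m u) <= opnorm B * enorm u.
Proof.
have [/enorm_eq0 ->|u0] := eqVneq (enorm u) 0.
  by rewrite mulmx0 /enorm !dot0l sqrtr0 mulr0.
have u_gt0 : 0 < enorm u by rewrite lt_neqAle eq_sym u0 enorm_ge0.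
rewrite -ler_pdivrMr//.
apply: (sup_upper_bound (opnorm_has_sup B)); exists ((enorm u)^-1 *: u) => /=.
  by rewrite enormZ ger0_norm ?invr_ge0 ?enorm_ge0// mulVf.
by rewrite -scalemxAr enormZ ger0_norm ?invr_ge0 ?enorm_ge0// mulrC.
Qed.

Lemma opnorm_eq0 M N (B : 'M[R]_(M, N)) (u : 'cV[R]_N) : opnorm B = 0 -> B *m u = 0.
Proof.
move=> B0; apply: enorm_eq0; apply/eqP; rewrite eq_le enorm_ge0 andbT.
by rewrite (le_trans (enorm_mulmx_le B u))// B0 mul0r.
Qed.

End EuclideanTheory.

(** * Conjugates, convexity and proximal points *)

Section ConvexTheory.
Context {R : realType} {N : nat}.
Implicit Types (h : 'cV[R]_N -> \bar R) (u v x : 'cV[R]_N).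

Lemma fenchel_gtNy h v : proper_fun h -> (-oo < fenchel h v)%E.
Proof.
move=> [hNy [u hu]]; apply: (@lt_le_trans _ _ ((dot u v)%:E - h u)%E); last first.
  by apply: ereal_sup_ubound; exists u.
by rewrite -(@fineK _ (h u)) ?fin_real ?hNy// ltNyr.
Qed.

Lemma convex_efun_fine h u v (t : R) : (forall x, (-oo < h x)%E) -> convex_efun h ->
  0 < t < 1 -> (h u < +oo)%E -> (h v < +oo)%E ->
  (h (t *: u + (1 - t) *: v)%R <= (t * fine (h u) + (1 - t) * fine (h v))%:E)%E.
Proof.
move=> hNy hc t01 hu hv; apply: le_trans (hc _ _ _ t01) _.
have -> : h u = (fine (h u))%:E by rewrite fineK// fin_real// hNy.
have -> : h v = (fine (h v))%:E by rewrite fineK// fin_real// hNy.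
by rewrite -!EFinM -EFinD.
Qed.

(** The conjugate is a supremum of affine functions of the dual variable; points where [h] is +oo
    contribute -oo. *)
Lemma fenchel_convex h : proper_fun h -> convex_efun (fenchel h).
Proof.
move=> hp v w t /andP[t0 t1].
have t1' : 0 < 1 - t by rewrite subr_gt0.
apply: ge_ereal_sup => _ [u _ <-].
have [hu|] := ltP (h u) +oo%E; last first.
  by rewrite leye_eq => /eqP ->; rewrite addeNy leNye.
have hf : h u = (fine (h u))%:E by rewrite fineK ?fin_real// hu (proj1 hp).
have fv : ((dot u v)%:E - h u <= fenchel h v)%E by apply: ereal_sup_ubound; exists u.
have fw : ((dot u w)%:E - h u <= fenchel h w)%E by apply: ereal_sup_ubound; exists u.
have t0E : (0 <= t%:E)%E by rewrite lee_fin ltW.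
have t1E : (0 <= (1 - t)%:E)%E by rewrite lee_fin ltW.
apply: le_trans (leeD (lee_wpmul2l t0E fv) (lee_wpmul2l t1E fw)).
rewrite hf -!EFinB -!EFinM -EFinD lee_fin !dotE le_eqVlt; apply/orP; left; apply/eqP; ring.
Qed.

Lemma prox_ltey (t : R) h x u v : prox t h x u -> (h v < +oo)%E -> (h u < +oo)%E.
Proof.
move=> /(_ v) hu hv; rewrite ltey; apply: contraTneq isT => hy.
move: hu; rewrite hy addye// leye_eq; case: (h v) hv => // r _.
Qed.

(** Strong convexity of the proximal objective: testing the minimality of [u] at
    [s *: v + (1 - s) *: u] and dividing by [s] gives the claim with a factor [1 - s] on the last
    term, and [s] can be taken arbitrarily small. *)
Lemma prox_three_point (t : R) h x u v : 0 < t -> (forall z, (-oo < h z)%E) ->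
  convex_efun h -> prox t h x u -> (h v < +oo)%E ->
  fine (h u) + (2 * t)^-1 * dot (u - x) (u - x) + (2 * t)^-1 * dot (v - u) (v - u)
    <= fine (h v) + (2 * t)^-1 * dot (v - x) (v - x).
Proof.
move=> t0 hNy hc pu hv; have hu := prox_ltey pu hv.
set q := (2 * t)^-1; have q0 : 0 < q by rewrite invr_gt0 mulr_gt0.
have key s : 0 < s < 1 -> fine (h u) + q * dot (u - x) (u - x)
    + (1 - s) * (q * dot (v - u) (v - u)) <= fine (h v) + q * dot (v - x) (v - x).
  move=> s01; have /andP[s0 s1] := s01.
  have := pu (s *: v + (1 - s) *: u).
  rewrite -(@fineK _ (h u)) ?fin_real ?hNy// !enorm2 div1r -/q => le1.
  have := le_trans le1 (leeD2r _ (convex_efun_fine hNy hc s01 hv hu)).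
  rewrite -!EFinD lee_fin => le2; rewrite -(ler_pM2l s0).
  have -> : s * (fine (h v) + q * dot (v - x) (v - x)) = fine (h u) + q * dot (u - x) (u - x)
      + s * (fine (h v) + q * dot (v - x) (v - x)) - (fine (h u) + q * dot (u - x) (u - x)).
    by ring.
  move: le2; rewrite -subr_ge0 => le2; rewrite -subr_ge0; apply: le_trans le2 _.
  rewrite !dotE !(dotC x) !(dotC u v) le_eqVlt; apply/orP; left; apply/eqP; ring.
set b := q * dot (v - u) (v - u) in key *.
have b0 : 0 <= b by rewrite mulr_ge0 ?dot_ge0 // ltW.
apply/ler_addgt0Pr => e e0.
have [s s01 sb] : exists2 s, 0 < s < 1 & s * b <= e.
  exists (e / (e + b + 1)).
    rewrite divr_gt0 ?ltr_pdivrMr ?mul1r /=; lra.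
  rewrite mulrAC ler_pdivrMr; last by lra.
  by rewrite ler_wpM2l ?ltW//; lra.
have := key _ s01; lra.
Qed.

(** Testing each minimizer against the other and adding the two three-point inequalities leaves a
    positive multiple of |u - v|^2 that is at most 0. *)
Lemma prox_unique (t : R) h x u v : 0 < t -> (forall z, (-oo < h z)%E) ->
  convex_efun h -> edom h !=set0 -> prox t h x u -> prox t h x v -> u = v.
Proof.
move=> t0 hNy hc [w hw] pu pv.
have uv := prox_three_point t0 hNy hc pu (prox_ltey pv hw).
have vu := prox_three_point t0 hNy hc pv (prox_ltey pu hw).
have q0 : 0 < (2 * t)^-1 by rewrite invr_gt0 mulr_gt0.
apply/esym/eqP; rewrite -subr_eq0; apply/eqP/dot_eq0/eqP.
rewrite eq_le dot_ge0 andbT -(@pmulr_rle0 _ (2 * t)^-1)//.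
have := mulr_ge0 (ltW q0) (dot_ge0 (u - v)); lra.
Qed.

End ConvexTheory.

(** * Lower semicontinuity, compactness and the domain of the conjugate *)

Section LowerSemicontinuity.
Context {R : realType}.

Lemma ereal_between (a b : \bar R) : (a < b)%E ->
  exists r : R, (a < r%:E)%E /\ (r%:E < b)%E.
Proof.
case: a b => [a| |] [b| |] //= ab.
- exists ((a + b) / 2); move: ab; rewrite !lte_fin; lra.
- by exists (a + 1); rewrite lte_fin ltry; split=> //; lra.
- by exists (b - 1); rewrite lte_fin ltNyr; split=> //; lra.
- by exists 0; rewrite ltNyr ltry.
Qed.

Lemma seq_has_min (s : seq R) : s != [::] -> exists2 r, r \in s & forall t, t \in s -> r <= t.
Proof.
elim: s => // a s IH _; have [->|/IH[r rs rmin]] := eqVneq s [::].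
  by exists a; rewrite ?mem_head// => t; rewrite inE => /eqP ->.
have [ar|ra] := leP a r.
  exists a; first exact: mem_head.
  by move=> t; rewrite inE => /predU1P[->//|/rmin]; exact: le_trans.
exists r; first by rewrite inE rs orbT.
by move=> t; rewrite inE => /predU1P[->|/rmin//]; exact: ltW.
Qed.

(** Without a minimum, the open sets [h > r], for [r] strictly above some value of [h] on [K], would
    cover [K]. In a finite subcover, a point whose value is below the smallest [r] is covered by no
    set. *)
Lemma lower_semicontinuous_min (T : ptopologicalType) (h : T -> \bar R) (K : set T) :
  compact K -> K !=set0 -> lower_semicontinuous h ->
  exists2 u, K u & forall v, K v -> (h u <= h v)%E.
Proof.
move=> cK [x0 Kx0] /lower_semicontinuousP hl; apply: contrapT => nmin.
have lower u : K u -> exists2 v, K v & (h v < h u)%E.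
  move=> Ku; apply: contrapT => nv; apply: nmin; exists u => // v Kv.
  by rewrite leNgt; apply/negP => vu; apply: nv; exists v.
move: cK; rewrite compact_cover.
move=> /(_ _ [set r | exists2 v, K v & (h v < r%:E)%E] (fun r => [set x | (r%:E < h x)%E])).
case=> [r _||D' D'D Kcov]; first exact: hl.
  move=> u Ku; have [v Kv /ereal_between[r [vr ru]]] := lower u Ku.
  by exists r => //; exists v.
have [r0 r0D' _] := Kcov _ Kx0.
have [|r rD' rmin] := @seq_has_min (finmap.enum_fset D').
  by apply: contraTneq r0D' => D'0; rewrite /= -[_ \in _]/(r0 \in finmap.enum_fset D') D'0.
have /set_mem[v Kv vr] := D'D _ rD'.
have [t tD' tv] := Kcov _ Kv.
have := lt_trans tv vr; rewrite lte_fin ltNge => /negP; apply; exact: rmin.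
Qed.

Lemma lower_semicontinuousD (T : topologicalType) (h : T -> \bar R) (phi : T -> R) :
  (forall x, (-oo < h x)%E) -> lower_semicontinuous h -> continuous phi ->
  lower_semicontinuous (fun x => h x + (phi x)%:E)%E.
Proof.
move=> hNy hl cphi x a ax.
have [b [b1 b2]] : exists b : R, ((a - phi x)%:E < b%:E)%E /\ (b%:E < h x)%E.
  by apply: ereal_between; rewrite EFinB lteBlDr.
have [V nV Vb] := hl _ _ b2.
exists (V `&` [set y | phi x - (b - (a - phi x)) < phi y]); last first.
  move=> y [/Vb hb /= py]; rewrite -lteBlDr// -EFinB (lt_trans _ hb)// lte_fin; lra.
apply: filterI => //; move/cvgr_gt : (cphi x); apply.
by move: b1; rewrite lte_fin; lra.
Qed.

Lemma trmx_continuous M N : continuous (fun u : 'M[R]_(M, N) => u^T).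
Proof.
move=> x B [S xS SB]; exists (fun i j => S j i) => [i j|y yS].
  by have := xS j i; rewrite mxE.
by apply: SB => i j; rewrite mxE; exact: yS.
Qed.

Lemma box_compact N (a : 'cV[R]_N) (r : R) :
  compact [set u : 'cV[R]_N | forall i, `[a i 0 - r, a i 0 + r]%classic (u i 0)].
Proof.
have -> : [set u : 'cV[R]_N | forall i, `[a i 0 - r, a i 0 + r]%classic (u i 0)]
  = trmx @` [set v : 'rV[R]_N | forall i, `[a i 0 - r, a i 0 + r]%classic (v ord0 i)].
  apply/seteqP; split => u /=.
    by move=> ur; exists u^T; rewrite ?trmxK// => i; rewrite mxE; exact: ur.
  by move=> [v vr <-] i; rewrite mxE; exact: vr.
apply: continuous_compact.
  by apply: continuous_subspaceT; exact: trmx_continuous.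
by apply: (@rV_compact R N (fun i => `[a i 0 - r, a i 0 + r]%classic)) => i; exact: segment_compact.
Qed.

Lemma dot_continuous N (a : 'cV[R]_N) (q : R) :
  continuous (fun u : 'cV[R]_N => q * dot (u - a) (u - a)).
Proof.
have cc i : continuous (fun v : 'cV[R]_N => (v - a) i 0).
  have -> : (fun v : 'cV[R]_N => (v - a) i 0) = (fun v => v i 0 - a i 0).
    by apply/funext => v; rewrite !mxE.
  by move=> u; exact: (cvgB (@coord_continuous R N 1 i 0 u) (cvg_cst (a i 0))).
have cs : continuous (fun v : 'cV[R]_N => \sum_i (v - a) i 0 * (v - a) i 0).
  apply: continuous_big => [|i _]; first exact: add_continuous.
  have cm : continuous (fun v : 'cV[R]_N => (v - a) i 0 * (v - a) i 0).
    by move=> u; exact: (cvgM (cc i u) (cc i u)).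
  exact: cm.
by move=> u; exact: (cvgM (cvg_cst q) (cs u)).
Qed.

(* A proper lsc convex function has a finite conjugate somewhere: minimise the
   function plus a steep quadratic over a box; a minimiser interior to the box is
   a proximal point, and the three-point inequality exhibits an affine minorant. *)
Lemma fenchel_dom N (h : 'cV[R]_N -> \bar R) : proper_lsc_convex h -> edom (fenchel h) !=set0.
Proof.
move=> [[hNy [u0 hu0]] hl hc].
pose K := [set u : 'cV[R]_N | forall i, `[u0 i 0 - 1, u0 i 0 + 1]%classic (u i 0)].
have inK (u : 'cV[R]_N) : dot (u - u0) (u - u0) <= 1 -> K u.
  move=> u1 i /=; have : (u i 0 - u0 i 0) ^+ 2 <= 1.
    apply: le_trans u1; rewrite /dot (bigD1 i)//= !mxE expr2 lerDl.
    by apply: sumr_ge0 => j _; rewrite -expr2 sqr_ge0.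
  by rewrite in_itv /= => u2; apply/andP; split; nra.
have Kn0 : K !=set0 by exists u0; apply: inK; rewrite subrr dot0l.
have cK : compact K by exact: box_compact.
have [um Kum hum] := lower_semicontinuous_min cK Kn0 hl.
have Ku0 : K u0 by apply: inK; rewrite subrr dot0l.
have hfin u : (h u < +oo)%E -> h u = (fine (h u))%:E by move=> ?; rewrite fineK// fin_real// hNy.
have umfin : h um = (fine (h um))%:E by apply/hfin/(le_lt_trans _ hu0)/hum.
(* With this [q], the minimizer [u] of the penalized function satisfies q |u - u0|^2 <= h(u0) - M =
   q - 1, which puts it in the open unit ball around [u0]. *)
set M := fine (h um) in umfin; set q := fine (h u0) - M + 1.
have Mle v : K v -> (h v < +oo)%E -> M <= fine (h v).
  by move=> Kv hv; have := hum _ Kv; rewrite umfin (hfin v)// lee_fin.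
have q1 : 1 <= q by have := Mle _ Ku0 hu0; rewrite /q; lra.
have [u Ku Fu] : exists2 u : 'cV[R]_N, K u & forall v : 'cV[R]_N, K v ->
    (h u + (q * dot (u - u0) (u - u0))%:E <= h v + (q * dot (v - u0) (v - u0))%:E)%E.
  exact: lower_semicontinuous_min cK Kn0
    (lower_semicontinuousD hNy hl (@dot_continuous N u0 q)).
have hu : (h u < +oo)%E.
  move: (Fu _ Ku0); rewrite (hfin u0)// -EFinD ltey; apply: contra_leN => /eqP ->.
  by rewrite addye// ltry.
have q0 : 0 < q by lra.
have D1 : dot (u - u0) (u - u0) < 1.
  move: (Fu _ Ku0); rewrite (hfin u0)// (hfin u)// -!EFinD lee_fin subrr dot0l mulr0.
  rewrite -(ltr_pM2l q0) => le1; have := Mle _ Ku hu; rewrite mulr1; move: le1; rewrite /q; lra.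
(* Minimality over the box extends to every [v]: convexity compares [u] with [v] through a point of
   the segment close enough to [u] to stay in the box. *)
have pu : prox (2 * q)^-1 h u0 u.
  move=> v; have [hv|] := ltP (h v) +oo%E; last first.
    by rewrite leye_eq => /eqP ->; rewrite addye// leey.
  rewrite !enorm2.
  have -> : 1 / (2 * (2 * q)^-1) = q by field; rewrite ?mulf_neq0 ?gt_eqF.
  set D := dot (u - u0) (u - u0) in D1 *; set V := dot (v - u0) (v - u0).
  have D0 : 0 <= D by exact: dot_ge0.
  have V0 : 0 <= V by exact: dot_ge0.
  (* Since s (V + 2) = 1 - D, the bound s V + (1 - s) D on the squared distance to [u0] is at most
     1. *)
  pose s : R := (1 - D) / (V + 2).
  have s01 : 0 < s < 1 by rewrite divr_gt0 ?ltr_pdivrMr /=; lra.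
  have /andP[s0 s1] := s01.
  have W : dot (s *: v + (1 - s) *: u - u0) (s *: v + (1 - s) *: u - u0) <= s * V + (1 - s) * D.
    rewrite -subr_ge0.
    have -> : s * V + (1 - s) * D - dot (s *: v + (1 - s) *: u - u0) (s *: v + (1 - s) *: u - u0)
        = s * (1 - s) * dot (v - u) (v - u).
      by rewrite /V /D !dotE !(dotC u0) !(dotC u v); ring.
    apply: mulr_ge0; [by apply: mulr_ge0; lra|exact: dot_ge0].
  have sV : s * V + (1 - s) * D <= 1.
    have : s * (V + 2) = 1 - D by rewrite /s divfK// gt_eqF//; lra.
    nra.
  have hw := convex_efun_fine hNy hc s01 hv hu.
  have := le_trans (Fu _ (inK _ (le_trans W sV))) (leeD2r _ hw).
  rewrite (hfin u)// (hfin v)// -!EFinD !lee_fin /= -/D -/V => le1.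
  rewrite -(ler_pM2l s0).
  have := ler_wpM2l (ltW q0) W; lra.
(* The optimality condition of the proximal point makes [z] a subgradient of [h] at [u], so the
   supremum defining the conjugate at [z] is attained at [u]. *)
pose z := (2 * q) *: (u0 - u).
exists z; rewrite /edom /=.
apply: (@le_lt_trans _ _ (dot u z - fine (h u))%:E); last exact: ltry.
apply: ge_ereal_sup => _ [v _ <-].
have [hv|] := ltP (h v) +oo%E; last first.
  by rewrite leye_eq => /eqP ->; rewrite addeNy leNye.
rewrite (hfin v)// -EFinB lee_fin.
have t0 : 0 < (2 * q)^-1 by rewrite invr_gt0 mulr_gt0.
have := prox_three_point t0 hNy hc pu hv.
have -> : (2 * (2 * q)^-1)^-1 = q by field; rewrite ?mulf_neq0 ?gt_eqF.
rewrite /z !dotE !(dotC u0) !(dotC u v); lra.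
Qed.

End LowerSemicontinuity.

(** * Separable functions on block vectors and their conjugates *)

Section Separable.
Context {R : realType} {n : nat} {m : 'I_n -> nat}.
Implicit Types (f : forall i, 'cV[R]_(m i) -> \bar R) (y : 'cV[R]_(\sum_i m i)).

Lemma dot_submxcol (u v : 'cV[R]_(\sum_i m i)) :
  dot u v = \sum_i dot (submxcol u i) (submxcol v i).
Proof.
rewrite dot_mx -[u in LHS]submxcolK -[v in LHS]submxcolK tr_mxcol mul_mxrow_mxcol summxE.
by apply: eq_bigr => i _; rewrite dot_mx.
Qed.

Lemma submxcol_blockdiag (a : 'I_n -> R) y i :
  submxcol (blockdiag a *m y) i = a i *: submxcol y i.
Proof.
by rewrite -[y in LHS]submxcolK mul_mxdiag_mxcol mxcolK mul_scalar_mx.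
Qed.

Lemma proper_sepsum f : (forall i, proper_fun (f i)) -> proper_fun (sepsum f).
Proof.
move=> hf; split=> [x|].
  rewrite ltNye /sepsum esum_eqNy; apply/negP => /existsP[i /eqP fi].
  by have := proj1 (hf i) (submxcol x i); rewrite fi.
exists (\mxcol_i projT1 (cid (proj2 (hf i)))); apply: lte_sum_pinfty => i _.
by rewrite mxcolK; case: cid.
Qed.

(** One inequality holds term by term. For the other, when the conjugate of the sum is finite,
    near-maximizers of the blocks are assembled into one competitor. *)
Lemma fenchel_sepsum f y : (forall i, proper_fun (f i)) ->
  fenchel (sepsum f) y = (\sum_i fenchel (f i) (submxcol y i))%E.
Proof.
move=> hf; have hNy i u : (-oo < f i u)%E by exact: (proj1 (hf i)).
have hfin i u : (f i u < +oo)%E -> f i u = (fine (f i u))%:E.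
  by move=> ?; rewrite fineK// fin_real// hNy.
have [u0 fu0] : {u0 : forall i, 'cV[R]_(m i) & forall i, (f i (u0 i) < +oo)%E}.
  by exists (fun i => projT1 (cid (proj2 (hf i)))) => i; case: cid.
have sumfin (u : forall i, 'cV[R]_(m i)) : (forall i, (f i (u i) < +oo)%E) ->
    (\sum_i dot (u i) (submxcol y i) - \sum_i fine (f i (u i)))%:E = 
    ((dot (\mxcol_i u i) y)%:E - sepsum f (\mxcol_i u i))%E.
  move=> fu; rewrite EFinB dot_submxcol -[in X in (_ - X)%E]sumEFin /sepsum; congr (_ - _)%E.
    by congr (_%:E); apply: eq_bigr => i _; rewrite mxcolK.
  by apply: eq_bigr => i _; rewrite mxcolK -hfin.
apply/eqP; rewrite eq_le; apply/andP; split.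
  apply: ge_ereal_sup => _ [u _ <-].
  have [fu|/existsNP[i]] := pselect (forall i, (f i (submxcol u i) < +oo)%E); last first.
    move/negP; rewrite -leNgt leye_eq => /eqP fy.
    suff -> : sepsum f u = +oo%E by rewrite addeNy leNye.
    apply/eqP; rewrite esum_eqy; first by apply/existsP; exists i; rewrite fy eqxx.
    by move=> j _; rewrite gt_eqF.
  rewrite -[u]submxcolK -sumfin// -sumrB -sumEFin; apply: lee_sum => i _.
  by rewrite EFinB -hfin//; apply: ereal_sup_ubound; exists (submxcol u i).
have [My|] := ltP (fenchel (sepsum f) y) +oo%E; last by rewrite leye_eq => /eqP ->; rewrite leey.
have Mle (u : forall i, 'cV[R]_(m i)) : (forall i, (f i (u i) < +oo)%E) ->
    \sum_i dot (u i) (submxcol y i) - \sum_i fine (f i (u i)) <= fine (fenchel (sepsum f) y).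
  move=> fu; rewrite -lee_fin sumfin// fineK; last first.
    rewrite fin_real// My andbT; apply: lt_le_trans (ltNyr _) _; last first.
      by apply: ereal_sup_ubound; exists (\mxcol_i u0 i) => //; rewrite -sumfin.
  by apply: ereal_sup_ubound; exists (\mxcol_i u i).
have My' : fenchel (sepsum f) y = (fine (fenchel (sepsum f) y))%:E.
  rewrite fineK// fin_real// My andbT; apply: lt_le_trans (ltNyr _) _; last first.
    by apply: ereal_sup_ubound; exists (\mxcol_i u0 i) => //; rewrite -sumfin.
rewrite My'; set M := fine _ in Mle *.
pose G i (u : 'cV[R]_(m i)) := dot u (submxcol y i) - fine (f i u).
have GM (u : forall i, 'cV[R]_(m i)) : (forall i, (f i (u i) < +oo)%E) -> \sum_i G i (u i) <= M.
  by move=> fu; rewrite sumrB; exact: Mle.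
(* Only block [i] varies while the others stay at [u0], so a bound on the whole sum bounds this
   block. *)
have Ffin i : fenchel (f i) (submxcol y i) = (fine (fenchel (f i) (submxcol y i)))%:E.
  rewrite fineK// fin_real// fenchel_gtNy//=.
  apply: (@le_lt_trans _ _ (M - \sum_(j | j != i) G j (u0 j))%:E); last exact: ltry.
  apply: ge_ereal_sup => _ [u _ <-].
  have [fu|] := ltP (f i u) +oo%E; last by rewrite leye_eq => /eqP ->; rewrite addeNy leNye.
  rewrite (hfin i u)// -EFinB lee_fin lerBrDr.
  have fw j : (f j (dfwith u0 i u j) < +oo)%E by case: dfwithP.
  have := GM _ fw; rewrite (bigD1 i)//= dfwithin (eq_bigr (fun j => G j (u0 j)))// => j ji.
  by rewrite dfwithout// eq_sym.
rewrite (eq_bigr _ (fun i _ => Ffin i)) sumEFin lee_fin.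
apply/ler_addgt0Pr => e e0.
(* The error is shared among the [n] blocks; [n.+1] keeps the denominator nonzero. *)
have en : 0 < e / n.+1%:R by rewrite divr_gt0.
have near i : exists2 u, (f i u < +oo)%E &
    fine (fenchel (f i) (submxcol y i)) <= G i u + e / n.+1%:R.
  have Fi : fenchel (f i) (submxcol y i) \is a fin_num by rewrite Ffin.
  have [_ [u _ <-]] := ub_ereal_sup_adherent en Fi.
  have [fu|] := ltP (f i u) +oo%E; last by rewrite leye_eq => /eqP ->; rewrite addeNy ltNge leNye.
  rewrite -/(fenchel (f i) (submxcol y i)) Ffin (hfin i u)// -!EFinB lte_fin => h.
  by exists u => //=; rewrite -lerBlDr ltW.
pose u i := projT1 (cid2 (near i)).
have fu i : (f i (u i) < +oo)%E by rewrite /u; case: cid2.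
have Fu i : fine (fenchel (f i) (submxcol y i)) <= G i (u i) + e / n.+1%:R.
  by rewrite /u; case: cid2.
apply: le_trans (ler_sum _ (fun i _ => Fu i)) _.
rewrite big_split /= sumr_const card_ord; apply: lerD; first exact: GM.
rewrite -[leLHS]mulr_natr mulrAC ler_pdivrMr ?ltr0Sn// ler_wpM2l ?ler_nat//.
exact: ltW.
Qed.

End Separable.

(** * The inequality for one iteration *)

Section OneStep.
Context {R : realType} {d n : nat} {m : 'I_n -> nat}.
Variables (A_ : forall i, 'M[R]_(m i, d)) (p sigma : 'I_n -> R) (tau gamma : R).
Hypotheses (hp : forall i, 0 < p i) (htau : 0 < tau) (hsigma : forall i, 0 < sigma i).
Hypothesis hgamma : 0 <= gamma < 1.
Hypothesis hstep : forall i,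
  (p i)^-1 * tau * sigma i * opnorm (A_ i) ^+ 2 <= gamma ^+ 2.

Let W := dual_weights p sigma.

Lemma dual_weights_gt0 i : 0 < W i.
Proof. by rewrite mulr_gt0 ?invr_gt0. Qed.

(** Cauchy-Schwarz and the step size condition bound the square of the left side by gamma^2 X Y,
    where X and Y are the two weighted squares; then 4 X Y <= (X + Y)^2. *)
Lemma young_step i (v : 'cV[R]_d) (z : 'cV[R]_(m i)) :
  (p i)^-1 * dot (A_ i *m v) z
    <= gamma / 2 * (tau^-1 * dot v v) + gamma / 2 * (W i * dot z z).
Proof.
have /andP[g0 _] := hgamma.
set r := (p i)^-1 * opnorm (A_ i); set X := tau^-1 * dot v v; set Y := W i * dot z z.
have X0 : 0 <= X by apply: mulr_ge0 (dot_ge0 _); rewrite invr_ge0 ltW.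
have Y0 : 0 <= Y by apply: mulr_ge0 (dot_ge0 _); rewrite ltW// dual_weights_gt0.
have pi0 : 0 <= (p i)^-1 by rewrite invr_ge0 ltW.
apply: (@le_trans _ _ (r * (enorm v * enorm z))).
  rewrite /r -mulrA ler_wpM2l// mulrA (le_trans (cauchy_schwarz _ _))//.
  by rewrite ler_wpM2r ?enorm_ge0// enorm_mulmx_le.
have r0 : 0 <= r by rewrite mulr_ge0// opnorm_ge0.
rewrite -mulrDr -[leRHS]mulrA (mulrC _ (X + Y)) -ler_sqr ?nnegrE; last 2 first.
- by apply: mulr_ge0 => //; apply: mulr_ge0; exact: enorm_ge0.
- by apply: mulr_ge0 => //; lra.
have le1 : (r * (enorm v * enorm z)) ^+ 2 <= gamma ^+ 2 * (X * Y).
  rewrite !exprMn !enorm2 /X /Y /W /dual_weights.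
  have -> : gamma ^+ 2 * (tau^-1 * dot v v * ((sigma i)^-1 / p i * dot z z))
    = gamma ^+ 2 * ((tau^-1 * (sigma i)^-1 / p i) * (dot v v * dot z z)) by ring.
  rewrite [leRHS]mulrA; apply: ler_wpM2r; first by apply: mulr_ge0; exact: dot_ge0.
  have -> : (p i)^-1 ^+ 2 * opnorm (A_ i) ^+ 2 = ((p i)^-1 * tau * sigma i * opnorm (A_ i) ^+ 2)
     * (tau^-1 * (sigma i)^-1 / p i) by field; rewrite !gt_eqF.
  by apply: ler_wpM2r => //; rewrite !mulr_ge0 ?invr_ge0 ?ltW.
apply: (le_trans le1); rewrite exprMn ler_wpM2l ?sqr_ge0//.
have := sqr_ge0 (X - Y); nra.
Qed.

(** A Lyapunov function: [xp] is the previous primal point, [Y] the current dual point and [D] the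
    last dual increment. The cross term comes from the extrapolation, and the square of [D] is there
    to absorb it through [young_step]. *)
Definition potential (a : 'cV[R]_d) (b : forall j, 'cV[R]_(m j)) (xp : 'cV[R]_d)
    (Y D : forall j, 'cV[R]_(m j)) : R :=
  (2 * tau)^-1 * dot (a - xp) (a - xp)
  + \sum_j (W j / 2 * dot (b j - Y j) (b j - Y j)
            - (p j)^-1 * dot (A_ j *m (xp - a)) (D j)
            + gamma / 2 * (W j * dot (D j) (D j))).

(* [D] is the previous dual increment, supported on the previously drawn block;
   [dl] is the full dual update, of which the indicator [e] selects a block. *)
Lemma one_step (a x xp : 'cV[R]_d) (b Y D dl : forall j, 'cV[R]_(m j))
    (e : 'I_n -> R) (i0 : 'I_n) (gx ga : R) (fh fb : 'I_n -> R) :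
  (forall j, e j * e j = e j) ->
  (forall j, j != i0 -> D j = 0) ->
  (let z := xp - tau *: \sum_j ((A_ j)^T *m (Y j + (p j)^-1 *: D j)) in
   gx + (2 * tau)^-1 * dot (x - z) (x - z) + (2 * tau)^-1 * dot (a - x) (a - x)
     <= ga + (2 * tau)^-1 * dot (a - z) (a - z)) ->
  (forall j, let z := Y j + sigma j *: (A_ j *m x) in
   fh j + (2 * sigma j)^-1 * dot (Y j + dl j - z) (Y j + dl j - z)
     + (2 * sigma j)^-1 * dot (b j - (Y j + dl j)) (b j - (Y j + dl j))
     <= fb j + (2 * sigma j)^-1 * dot (b j - z) (b j - z)) ->
  gx - ga + \sum_j (fh j - fb j + dot (A_ j *m x) (b j) - dot (A_ j *m a) (Y j + dl j))
  <= potential a b xp Y D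
     - potential a b x (fun j => Y j + e j *: dl j) (fun j => e j *: dl j)
     - (1 - gamma) / 2 * \sum_j W j * dot (e j *: dl j) (e j *: dl j)
     + \sum_j (1 - e j / p j) * (dot (A_ j *m (x - a)) (dl j)
         + (sigma j)^-1 * dot (b j - Y j) (dl j) - (sigma j)^-1 * dot (dl j) (dl j)).
Proof.
move=> eE D0 hx hy; have /andP[g0 g1] := hgamma.
have {}hx : gx - ga <= - (\sum_j dot (A_ j *m (x - a)) (Y j + (p j)^-1 *: D j))
   - (2 * tau)^-1 * (dot (x - a) (x - a) + dot (x - xp) (x - xp) - dot (a - xp) (a - xp)).
  move: hx; set s := \sum_j _ => /= hx.
  have -> : \sum_j dot (A_ j *m (x - a)) (Y j + (p j)^-1 *: D j) = dot (x - a) s.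
    by rewrite /s dot_sumr; apply: eq_bigr => j _; rewrite dot_mulmx.
  apply: (ler_eq_sub _ hx); rewrite !dotE !(dotC s) !(dotC xp) !(dotC a x).
  by field; rewrite gt_eqF.
have {}hy j : fh j - fb j <= dot (A_ j *m x) (Y j + dl j - b j) - (2 * sigma j)^-1 *
   (dot (Y j + dl j - b j) (Y j + dl j - b j) + dot (dl j) (dl j) - dot (b j - Y j) (b j - Y j)).
  move: (hy j) => /=; set s := A_ j *m x.
  apply: ler_eq_sub; rewrite !dotE !(dotC s) !(dotC (b j)) !(dotC (dl j) (Y j)).
  by field; rewrite gt_eqF.
(* The price of replacing [xp] by [x] in the cross term. Only block [i0] contributes, and the factor
   [gamma] on |x - xp|^2 is relaxed to 1. *)
have young : - (\sum_j (p j)^-1 * dot (A_ j *m (x - xp)) (D j)) <=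
    (2 * tau)^-1 * dot (x - xp) (x - xp) + \sum_j gamma / 2 * (W j * dot (D j) (D j)).
  rewrite (bigD1 i0)//= big1 ?addr0; last by move=> j ji; rewrite D0// dot0r mulr0.
  rewrite [X in _ <= _ + X](bigD1 i0)//= [X in _ <= _ + (_ + X)]big1 ?addr0; last first.
    by move=> j ji; rewrite D0// dot0r !mulr0.
  have := young_step (- (x - xp)) (D i0).
  rewrite mulmxN !dotNl dotNr opprK mulrN => /le_trans; apply; rewrite lerD2r.
  rewrite -mulrA invfM -!(mulrA 2^-1); apply: ler_piMl; last exact: ltW.
  rewrite mulr_ge0 ?invr_ge0//; apply: mulr_ge0 (dot_ge0 _); by rewrite invr_ge0 ltW.
(* Blockwise bookkeeping: passing from the full update [dl j] to the selected one [e j *: dl j]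
   leaves exactly the terms with factor [1 - e j / p j]. *)
have ident : \sum_j (- dot (A_ j *m (x - a)) (Y j + (p j)^-1 *: D j)
    + (dot (A_ j *m x) (Y j + dl j - b j) - (2 * sigma j)^-1 *
   (dot (Y j + dl j - b j) (Y j + dl j - b j) + dot (dl j) (dl j) - dot (b j - Y j) (b j - Y j)))
    + (dot (A_ j *m x) (b j) - dot (A_ j *m a) (Y j + dl j))
    + (p j)^-1 * dot (A_ j *m (x - xp)) (D j) + gamma / 2 * (W j * dot (D j) (D j)))
  = \sum_j ((W j / 2 * dot (b j - Y j) (b j - Y j)
            - (p j)^-1 * dot (A_ j *m (xp - a)) (D j)
            + gamma / 2 * (W j * dot (D j) (D j)))
   - (W j / 2 * dot (b j - (Y j + e j *: dl j)) (b j - (Y j + e j *: dl j))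
            - (p j)^-1 * dot (A_ j *m (x - a)) (e j *: dl j)
            + gamma / 2 * (W j * dot (e j *: dl j) (e j *: dl j)))
   - (1 - gamma) / 2 * (W j * dot (e j *: dl j) (e j *: dl j))
   + (1 - e j / p j) * (dot (A_ j *m (x - a)) (dl j)
         + (sigma j)^-1 * dot (b j - Y j) (dl j) - (sigma j)^-1 * dot (dl j) (dl j))).
  apply: eq_bigr => j _; rewrite /W /dual_weights !mulmxBr !dotE.
  rewrite !(mulrA (e j) (e j)) !eE !(dotC (b j)) !(dotC (dl j) (Y j)).
  by field; rewrite !gt_eqF.
have hysum := ler_sum (index_enum 'I_n) (fun j (_ : true) => hy j).
move: ident hx hysum young; rewrite /potential /xnorm2 !big_split /= !sumrN !big_split /= !sumrN.
have -> : dot (a - x) (a - x) = dot (x - a) (x - a) by rewrite -(opprB x) dotNl dotNr opprK.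
rewrite -!mulr_sumr => ident hx hysum young.
lra.
Qed.

End OneStep.

(* A history lists the drawn indices, the latest one first. *)
Fixpoint acc (I : Type) (V : zmodType) (psi : seq I -> I -> V) (s : seq I) : V :=
  if s is i :: s' then acc psi s' + psi s' i else 0.

(* The factor [1 - (i == j)%:R / p j] has mean zero when [i] has law [p]. *)
Definition mart_incr (R : realType) (n : nat) (p : 'I_n -> R)
    (alpha : seq 'I_n -> 'I_n -> R) (s : seq 'I_n) (i : 'I_n) : R :=
  \sum_j (1 - (i == j)%:R / p j) * alpha s j.

(** Merges several martingale sums into one, so that a single mean has to be computed. *)
Lemma acc_mart_lin (R : realType) (n : nat) (p : 'I_n -> R)
    (al be : seq 'I_n -> 'I_n -> R) (k : R) s :
  acc (mart_incr p (fun s j => al s j + k * be s j)) s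
  = acc (mart_incr p al) s + k * acc (mart_incr p be) s.
Proof.
elim: s => [|i s IH] /=; first by rewrite mulr0 addr0.
rewrite IH mulrDr addrACA; congr (_ + _).
by rewrite /mart_incr mulr_sumr -big_split /=; apply: eq_bigr => j _; ring.
Qed.

(** * Pathwise inequalities on the tree of histories *)

Section Tree.
Context {R : realType} {d n : nat} {m : 'I_n -> nat}.
Variables (A_ : forall i, 'M[R]_(m i, d)) (p sigma : 'I_n -> R) (tau gamma : R).
Hypotheses (hp : forall i, 0 < p i) (htau : 0 < tau) (hsigma : forall i, 0 < sigma i).
Hypothesis hgamma : 0 <= gamma < 1.
Hypothesis hstep : forall i,
  (p i)^-1 * tau * sigma i * opnorm (A_ i) ^+ 2 <= gamma ^+ 2.

Let W := dual_weights p sigma.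

(* [X s] and [Y s] are x^k and y^k after the history [s] of length k - 1. *)
Variables (X : seq 'I_n -> 'cV[R]_d) (Y : seq 'I_n -> forall j, 'cV[R]_(m j)).
Variable x0 : 'cV[R]_d.

(** For a history of length k - 1, [prevX] is x^(k-1) and [incrY] is y^k - y^(k-1); the value 0 at
    the empty history reflects y^1 = y^0. *)
Definition prevX s := if s is _ :: s' then X s' else x0.
Definition incrY s j : 'cV[R]_(m j) := if s is _ :: s' then Y s j - Y s' j else 0.

(* The increment of block [j] if it is the one drawn after [s]; taken over all
   [j], this is the full dual update of the deterministic method. *)
Definition virtY s j : 'cV[R]_(m j) := Y (j :: s) j - Y s j.

(** Real-valued stand-ins for g and the conjugates of the f_j, with [Gd] and [Fd] in the role of
    their effective domains. *)
Variables (gr : 'cV[R]_d -> R) (fr : forall j, 'cV[R]_(m j) -> R).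
Variables (Gd : set 'cV[R]_d) (Fd : forall j, set 'cV[R]_(m j)).
Arguments fr : clear implicits.
Arguments Fd : clear implicits.

Hypothesis Y_kept : forall s i j, j != i -> Y (i :: s) j = Y s j.
Hypothesis X_prox : forall s a, Gd a ->
  let z := prevX s - tau *: \sum_j ((A_ j)^T *m (Y s j + (p j)^-1 *: incrY s j)) in
  gr (X s) + (2 * tau)^-1 * dot (X s - z) (X s - z)
    + (2 * tau)^-1 * dot (a - X s) (a - X s)
    <= gr a + (2 * tau)^-1 * dot (a - z) (a - z).
Hypothesis Y_prox : forall s j b, Fd j b ->
  let z := Y s j + sigma j *: (A_ j *m X s) in
  fr j (Y (j :: s) j) + (2 * sigma j)^-1 * dot (Y (j :: s) j - z) (Y (j :: s) j - z)
    + (2 * sigma j)^-1 * dot (b - Y (j :: s) j) (b - Y (j :: s) j)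
    <= fr j b + (2 * sigma j)^-1 * dot (b - z) (b - z).

Local Notation e i j := ((i == j)%:R : R).

Lemma Y_cons s i j : Y (i :: s) j = Y s j + e i j *: virtY s j.
Proof.
rewrite /virtY; have [<-|ij] := eqVneq i j; first by rewrite scale1r addrC subrK.
by rewrite scale0r addr0 Y_kept// eq_sym.
Qed.

Lemma incrY_cons s i j : incrY (i :: s) j = e i j *: virtY s j.
Proof. by rewrite /= Y_cons addrC addKr. Qed.

Lemma incrY_single s (i : 'I_n) : exists i0, forall j, j != i0 -> incrY s j = 0.
Proof.
case: s => [|i0 s]; first by exists i.
by exists i0 => j ji; rewrite incrY_cons eq_sym (negbTE ji) scale0r.
Qed.

Definition pot a b s := potential A_ p sigma tau gamma a b (prevX s) (Y s) (incrY s).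

Lemma pot_nil a b : pot a b [::] =
  (2 * tau)^-1 * dot (a - x0) (a - x0)
  + \sum_j W j / 2 * dot (b j - Y [::] j) (b j - Y [::] j).
Proof.
rewrite /pot /potential /=; congr (_ + _); apply: eq_bigr => j _.
by rewrite !dot0r !mulr0 subr0 addr0.
Qed.

(** By [young_step], the cross term is at most the square of the increment plus gamma times the
    primal distance term, and gamma < 1. *)
Lemma pot_ge a b s (i : 'I_n) :
  \sum_j W j / 2 * dot (b j - Y s j) (b j - Y s j) <= pot a b s.
Proof.
have /andP[g0 g1] := hgamma.
have [i0 D0] := incrY_single s i.
rewrite /pot /potential -subr_ge0 -addrA -sumrB.
have -> : \sum_j (W j / 2 * dot (b j - Y s j) (b j - Y s j)
   - (p j)^-1 * dot (A_ j *m (prevX s - a)) (incrY s j)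
   + gamma / 2 * (W j * dot (incrY s j) (incrY s j))
   - W j / 2 * dot (b j - Y s j) (b j - Y s j))
   = gamma / 2 * (W i0 * dot (incrY s i0) (incrY s i0))
     - (p i0)^-1 * dot (A_ i0 *m (prevX s - a)) (incrY s i0).
  rewrite (bigD1 i0)//= big1 ?addr0; first by ring.
  by move=> j ji; rewrite D0// !dot0r; ring.
have := young_step hp htau hsigma hgamma hstep (prevX s - a) (incrY s i0).
rewrite -[dot (prevX s - a) (prevX s - a)]dotNN opprB invfM -mulrA.
have : 0 <= tau^-1 * dot (a - prevX s) (a - prevX s).
  by apply: mulr_ge0 (dot_ge0 _); rewrite invr_ge0 ltW.
rewrite /W; nra.
Qed.

(** [one_step] with [virtY] as the full update. The left side evaluates every block at its own
    virtual update [Y (j :: s) j], not at the realized [Y (i :: s) j]. *)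
Lemma node_step a b s i : Gd a -> (forall j, Fd j (b j)) ->
  gr (X s) - gr a + \sum_j (fr j (Y (j :: s) j) - fr j (b j)
     + dot (A_ j *m X s) (b j) - dot (A_ j *m a) (Y (j :: s) j))
  <= pot a b s - pot a b (i :: s)
     - (1 - gamma) * \sum_j W j / 2 * dot (incrY (i :: s) j) (incrY (i :: s) j)
     + \sum_j (1 - e i j / p j) * (dot (A_ j *m (X s - a)) (virtY s j)
         + (sigma j)^-1 * dot (b j - Y s j) (virtY s j)
         - (sigma j)^-1 * dot (virtY s j) (virtY s j)).
Proof.
move=> Ga Fb; have [i0 D0] := incrY_single s i.
have eE j : e i j * e i j = e i j by case: eqVneq => _; rewrite ?mulr1 ?mulr0.
have EY : Y (i :: s) = (fun j => Y s j + e i j *: virtY s j).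
  by apply: functional_extensionality_dep => j; rewrite Y_cons.
have ED : incrY (i :: s) = (fun j => e i j *: virtY s j).
  by apply: functional_extensionality_dep => j; rewrite incrY_cons.
have Yv j : Y s j + virtY s j = Y (j :: s) j by rewrite /virtY addrC subrK.
have -> : \sum_j (fr j (Y (j :: s) j) - fr j (b j)
     + dot (A_ j *m X s) (b j) - dot (A_ j *m a) (Y (j :: s) j))
  = \sum_j (fr j (Y (j :: s) j) - fr j (b j)
     + dot (A_ j *m X s) (b j) - dot (A_ j *m a) (Y s j + virtY s j)).
  by apply: eq_bigr => j _; rewrite Yv.
have -> : (1 - gamma) * (\sum_j W j / 2 * dot (incrY (i :: s) j) (incrY (i :: s) j))
  = (1 - gamma) / 2 * \sum_j W j * dot (incrY (i :: s) j) (incrY (i :: s) j).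
  by rewrite -mulrA !mulr_sumr; apply: eq_bigr => j _; ring.
rewrite /pot EY ED; apply: (one_step hp htau hsigma hgamma hstep eE D0 (X_prox s Ga)) => j.
by rewrite Yv; exact: Y_prox.
Qed.

Definition sqincr s i := \sum_j W j / 2 * dot (incrY (i :: s) j) (incrY (i :: s) j).

(** * Comparison with the saddle point *)

Section Star.
Variables (xs : 'cV[R]_d) (ys : forall j, 'cV[R]_(m j)).
Hypotheses (Gxs : Gd xs) (Fys : forall j, Fd j (ys j)).
Hypotheses (GX : forall s, Gd (X s)) (FY : forall s j, Fd j (Y (j :: s) j)).
Hypothesis xs_subdiff : forall a, Gd a -> gr xs - \sum_j dot (A_ j *m (a - xs)) (ys j) <= gr a.
Hypothesis ys_subdiff : forall j b, Fd j b ->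
  fr j (ys j) + dot (A_ j *m xs) (b - ys j) <= fr j b.

Definition alpha_star s j := dot (A_ j *m (X s - xs)) (virtY s j)
  + (sigma j)^-1 * dot (ys j - Y s j) (virtY s j)
  - (sigma j)^-1 * dot (virtY s j) (virtY s j).

(** The gap increments at the saddle point are nonnegative, so the potential plus the accumulated
    squared increments grows only through the martingale; [pot_ge] then extracts the dual
    distance. *)
Lemma star_bound s (i : 'I_n) :
  \sum_j W j / 2 * dot (ys j - Y s j) (ys j - Y s j) + (1 - gamma) * acc sqincr s
  <= pot xs ys [::] + acc (mart_incr p alpha_star) s.
Proof.
apply: (@le_trans _ _ (pot xs ys s + (1 - gamma) * acc sqincr s)).
  by rewrite lerD2r; exact: pot_ge.
elim: s {i} => [|i s IH] /=; first by rewrite mulr0.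
have := node_step s i Gxs Fys.
have gap0 : 0 <= gr (X s) - gr xs + \sum_j (fr j (Y (j :: s) j) - fr j (ys j)
     + dot (A_ j *m X s) (ys j) - dot (A_ j *m xs) (Y (j :: s) j)).
  have -> : \sum_j (fr j (Y (j :: s) j) - fr j (ys j)
        + dot (A_ j *m X s) (ys j) - dot (A_ j *m xs) (Y (j :: s) j))
      = \sum_j dot (A_ j *m (X s - xs)) (ys j) + \sum_j (fr j (Y (j :: s) j)
        - (fr j (ys j) + dot (A_ j *m xs) (Y (j :: s) j - ys j))).
    by rewrite -big_split; apply: eq_bigr => j _; rewrite /= mulmxBr !dotE; ring.
  have le0 j : 0 <= fr j (Y (j :: s) j) - (fr j (ys j) + dot (A_ j *m xs) (Y (j :: s) j - ys j)).
    by rewrite subr_ge0 ys_subdiff.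
  have := sumr_ge0 (index_enum _) (fun j (_ : xpredT j) => le0 j).
  have := xs_subdiff (GX s); lra.
move=> /(le_trans gap0); rewrite /sqincr /mart_incr /alpha_star /= => h; lra.
Qed.

End Star.

(** * Comparison with an arbitrary point *)

Section Gap.
Variables (a : 'cV[R]_d) (b : forall j, 'cV[R]_(m j)).
Hypotheses (Ga : Gd a) (Fb : forall j, Fd j (b j)).

Definition gap_incr s i := gr (X s) - gr a + \sum_j (fr j (Y (i :: s) j) - fr j (b j)
  + dot (A_ j *m X s) (b j) - dot (A_ j *m a) (Y (i :: s) j)).

Definition noise j s (i : 'I_n) : 'cV[R]_(m j) := (1 - e i j / p j) *: virtY s j.

(** This centred coefficient is free of the comparison point: the part depending on [b] goes into
    [noise], the part depending on [a] into a telescoping sum. *)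
Definition alpha_gap s j := dot (A_ j *m X s) (virtY s j)
  + (sigma j)^-1 * dot (Y [::] j - Y s j) (virtY s j)
  - (sigma j)^-1 * dot (virtY s j) (virtY s j) - (fr j (Y (j :: s) j) - fr j (Y s j)).

Lemma gap_bound s : acc gap_incr s <= pot a b [::] - pot a b s
  + \sum_j ((p j)^-1 - 1) * (fr j (Y [::] j) - fr j (Y s j) + dot (A_ j *m a) (Y s j - Y [::] j))
  + \sum_j (sigma j)^-1 * dot (b j - Y [::] j) (acc (noise j) s)
  + acc (mart_incr p alpha_gap) s.
Proof.
have /andP[g0 g1] := hgamma.
elim: s => [|i s IH] /=.
  rewrite !big1 => [||j _]; first by lra.
  - by move=> j _; rewrite dot0r mulr0.
  - by rewrite !subrr dot0r addr0 mulr0.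
have sq0 : 0 <= (1 - gamma) * \sum_j W j / 2 * dot (incrY (i :: s) j) (incrY (i :: s) j).
  apply: mulr_ge0; first lra; apply: sumr_ge0 => j _.
  by rewrite mulr_ge0 ?dot_ge0// divr_ge0// ltW// dual_weights_gt0.
have step := node_step s i Ga Fb.
(* With e the indicator of the drawn block, realized and full updates differ by the factor 1 - e =
   (1 - e / p) + e (1 / p - 1): the first part is centred and the second telescopes. *)
suff ident : \sum_j (fr j (Y (i :: s) j) - fr j (b j)
     + dot (A_ j *m X s) (b j) - dot (A_ j *m a) (Y (i :: s) j))
   - \sum_j (fr j (Y (j :: s) j) - fr j (b j)
     + dot (A_ j *m X s) (b j) - dot (A_ j *m a) (Y (j :: s) j))
   + \sum_j (1 - e i j / p j) * (dot (A_ j *m (X s - a)) (virtY s j)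
         + (sigma j)^-1 * dot (b j - Y s j) (virtY s j)
         - (sigma j)^-1 * dot (virtY s j) (virtY s j))
   = \sum_j ((p j)^-1 - 1) * (fr j (Y [::] j) - fr j (Y (i :: s) j)
         + dot (A_ j *m a) (Y (i :: s) j - Y [::] j))
    - \sum_j ((p j)^-1 - 1) * (fr j (Y [::] j) - fr j (Y s j)
         + dot (A_ j *m a) (Y s j - Y [::] j))
    + (\sum_j (sigma j)^-1 * dot (b j - Y [::] j) (acc (noise j) s + noise j s i)
    - \sum_j (sigma j)^-1 * dot (b j - Y [::] j) (acc (noise j) s))
    + mart_incr p alpha_gap s i.
  rewrite /gap_incr; lra.
rewrite /mart_incr /alpha_gap -!sumrB -!big_split /=; apply: eq_bigr => j _.
move: (acc (noise j) s) => u; rewrite /noise /virtY; have [ij|ij] := eqVneq i j.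
  by rewrite ij /= mulmxBr !dotE; field; rewrite !gt_eqF.
rewrite Y_kept; last by rewrite eq_sym.
by rewrite /= mulmxBr !dotE; field; rewrite !gt_eqF.
Qed.

End Gap.

Definition alpha_noise s j :=
  (sigma j)^-1 * p j * (dot (acc (noise j) s) (virtY s j) + dot (virtY s j) (virtY s j)).

(* The noise paired with [b] is not centred once [b] is chosen in hindsight; Young's
   inequality trades the pairing for half of this square, whose growth is paid for
   by the squared dual increments. *)
Lemma noise_bound s :
  \sum_j (sigma j)^-1 * p j / 2 * dot (acc (noise j) s) (acc (noise j) s)
  <= acc sqincr s + acc (mart_incr p alpha_noise) s.
Proof.
elim: s => [|i s IH] /=; first by rewrite big1 ?addr0// => j _; rewrite dot0r mulr0.
suff le1 : \sum_j (sigma j)^-1 * p j / 2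
      * dot (acc (noise j) s + noise j s i) (acc (noise j) s + noise j s i)
    - \sum_j (sigma j)^-1 * p j / 2 * dot (acc (noise j) s) (acc (noise j) s)
    <= sqincr s i + mart_incr p alpha_noise s i by lra.
rewrite /mart_incr /sqincr /alpha_noise -sumrB -big_split /=; apply: ler_sum => j _.
rewrite -/(incrY (i :: s) j) incrY_cons /noise -subr_ge0.
move: (acc (noise j) s) (virtY s j) => u v.
(* Whether or not block [j] is drawn, the same nonnegative surplus is left. *)
have -> : W j / 2 * dot (e i j *: v) (e i j *: v)
    + (1 - e i j / p j) * ((sigma j)^-1 * p j * (dot u v + dot v v))
    - ((sigma j)^-1 * p j / 2 * dot (u + (1 - e i j / p j) *: v) (u + (1 - e i j / p j) *: v)
    - (sigma j)^-1 * p j / 2 * dot u u)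
  = (sigma j)^-1 * p j / 2 * dot v v.
  rewrite /W /dual_weights !dotE. rewrite (dotC v u).
  by case: (i == j); rewrite /=; field; rewrite !gt_eqF.
by rewrite mulr_ge0 ?dot_ge0// divr_ge0// mulr_ge0 ?invr_ge0// ltW.
Qed.

(** * The full estimate along one history *)

Section Path.
Variables (xs : 'cV[R]_d) (ys : forall j, 'cV[R]_(m j)).
Hypotheses (Gxs : Gd xs) (Fys : forall j, Fd j (ys j)).
Hypotheses (GX : forall s, Gd (X s)) (FY : forall s j, Fd j (Y (j :: s) j)).
Hypothesis xs_subdiff : forall a, Gd a -> gr xs - \sum_j dot (A_ j *m (a - xs)) (ys j) <= gr a.
Hypothesis ys_subdiff : forall j b, Fd j b ->
  fr j (ys j) + dot (A_ j *m xs) (b - ys j) <= fr j b.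
Hypothesis p_le1 : forall j, p j <= 1.
(* When [p j = 1] the weight [1 / p j - 1] of [fr j] vanishes, so that [y1] may lie
   outside the domain. *)
Hypothesis FY1 : forall s j, p j = 1 \/ Fd j (Y s j).
Variables (c c1 T : R).
Hypotheses (c_ge0 : 0 <= c) (c1_ge0 : 0 <= c1).
Hypothesis c_bound : forall (a : 'cV[R]_d) (z : forall j, 'cV[R]_(m j)),
  \sum_j ((p j)^-1 - 1) * dot (A_ j *m a) (z j)
    <= c / 2 * (tau^-1 * dot a a) + c / 2 * \sum_j W j * dot (z j) (z j).
Hypothesis T_bound : forall z : forall j, 'cV[R]_(m j),
  - (\sum_j ((p j)^-1 - 1) * dot (A_ j *m xs) (z j))
    <= T + c1 / 2 * \sum_j W j * dot (z j) (z j).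

(** The total multiple of [star_bound] that is spent: 1 / (1 - gamma) on the squared increments, 2c
    on the cross term and c1 on the conjugates. *)
Let kappa := 1 / (1 - gamma) + 2 * c + c1.

Definition alpha_path s j := (alpha_gap s j + 1 * alpha_noise s j) + kappa * alpha_star xs ys s j.

Lemma path_bound a b s (i : 'I_n) : Gd a -> (forall j, Fd j (b j)) ->
  acc (gap_incr a b) s
  <= (1 + 2 * c) / 2 * (tau^-1 * dot (x0 - a) (x0 - a))
     + \sum_j W j * dot (Y [::] j - b j) (Y [::] j - b j)
     + (\sum_j ((p j)^-1 - 1) * fr j (Y [::] j) - \sum_j ((p j)^-1 - 1) * fr j (ys j))
     + (kappa * (1 / 2 * (tau^-1 * dot (x0 - xs) (x0 - xs))
                 + 1 / 2 * \sum_j W j * dot (Y [::] j - ys j) (Y [::] j - ys j))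
        + c * (tau^-1 * dot x0 x0)
        + c * \sum_j W j * dot (Y [::] j - ys j) (Y [::] j - ys j) + T)
     + acc (mart_incr p alpha_path) s.
Proof.
move=> Ga Fb; have /andP[g0 g1] := hgamma.
have W0 j : 0 < W j by exact: dual_weights_gt0.
have sumW (u v : forall j, 'cV[R]_(m j)) : \sum_j W j / 2 * dot (u j - v j) (u j - v j)
    = 1 / 2 * \sum_j W j * dot (v j - u j) (v j - u j).
  by rewrite mulr_sumr; apply: eq_bigr => j _; rewrite -(opprB (u j)) dotNN; ring.
have potn xs' ys' : pot xs' ys' [::] = 1 / 2 * (tau^-1 * dot (x0 - xs') (x0 - xs'))
     + 1 / 2 * \sum_j W j * dot (Y [::] j - ys' j) (Y [::] j - ys' j).
  by rewrite pot_nil sumW -(opprB x0) dotNN invfM; congr (_ + _); ring.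
have := star_bound Gxs Fys GX FY xs_subdiff ys_subdiff s i.
have := gap_bound Ga Fb s; have := noise_bound s.
have := pot_ge a b s i.
rewrite !potn /alpha_path !acc_mart_lin [1 * acc _ _]mul1r.
rewrite (sumW ys (Y s)) (sumW b (Y s)).
set Ga0 := acc (mart_incr p alpha_gap) s; set No := acc (mart_incr p alpha_noise) s.
set St := acc (mart_incr p _) s; set Q : R := acc sqincr s.
set Dl := 1 / 2 * (tau^-1 * dot (x0 - xs) (x0 - xs))
  + 1 / 2 * \sum_j W j * dot (Y [::] j - ys j) (Y [::] j - ys j).
set U2 := \sum_j (sigma j)^-1 * p j / 2 * dot (acc (noise j) s) (acc (noise j) s).
set yd := \sum_j W j * dot (Y s j - ys j) (Y s j - ys j).
move=> pge noi gap sta.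
have yd0 : 0 <= yd.
  by apply: sumr_ge0 => j _; apply: mulr_ge0 (dot_ge0 _); exact: ltW.
have bd0 : 0 <= \sum_j W j * dot (Y s j - b j) (Y s j - b j).
  by apply: sumr_ge0 => j _; apply: mulr_ge0 (dot_ge0 _); exact: ltW.
have Q0 : 0 <= Q.
  rewrite /Q; elim: (s) => [|k s' IH] //=; rewrite addr_ge0// sumr_ge0// => j _.
  by apply: mulr_ge0 (dot_ge0 _); rewrite divr_ge0// ltW.
have starQ : Q <= 1 / (1 - gamma) * (Dl + St).
  by rewrite mul1r ler_pdivlMl ?subr_gt0//; lra.
have stary : 1 / 2 * yd <= Dl + St.
  have : 0 <= (1 - gamma) * Q by apply: mulr_ge0 => //; lra.
  lra.
(* Young's inequality, from the square of (b - y^1) / p - U in each block. Its half of |y^1 - b|^2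
   joins the half in the initial potential, whence the coefficient 1 in the final bound. *)
have noisey : \sum_j (sigma j)^-1 * dot (b j - Y [::] j) (acc (noise j) s)
    <= 1 / 2 * (\sum_j W j * dot (Y [::] j - b j) (Y [::] j - b j)) + U2.
  rewrite /U2 mulr_sumr -big_split /=; apply: ler_sum => j _.
  have s0 : 0 <= (sigma j)^-1 by rewrite invr_ge0 ltW.
  have := mulr_ge0 (mulr_ge0 s0 (ltW (hp j)))
    (dot_ge0 ((p j)^-1 *: (b j - Y [::] j) - acc (noise j) s)).
  rewrite -(opprB (b j)) dotNN /W /dual_weights.
  move: (acc _ s) (b j - _) => u v h.
  have : 0 <= (sigma j)^-1 * p j * dot ((p j)^-1 *: v - u) ((p j)^-1 *: v - u) / 2.
    by rewrite divr_ge0.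
  by apply: ler_eq_sub; rewrite !dotE (dotC u v); field; rewrite !gt_eqF.
(* The subgradient inequality at [ys] bounds the weighted conjugates from below, and [T_bound]
   controls the linear term that appears. *)
have drop : - \sum_j ((p j)^-1 - 1) * fr j (Y s j)
    <= - \sum_j ((p j)^-1 - 1) * fr j (ys j) + T + c1 / 2 * yd.
  apply: (@le_trans _ _ (- \sum_j ((p j)^-1 - 1) * fr j (ys j)
      - \sum_j ((p j)^-1 - 1) * dot (A_ j *m xs) (Y s j - ys j))); last first.
    by rewrite -addrA lerD2l T_bound.
  rewrite -opprD lerN2 -big_split /=; apply: ler_sum => j _; rewrite -mulrDr.
  have [->|FYs] := FY1 s j; first by rewrite invr1 subrr !mul0r.
  by rewrite ler_wpM2l ?ys_subdiff// subr_ge0 invf_ge1.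
(* After [c_bound], [a] is split through [x0] and the dual displacement through [ys], each at the
   cost of a factor 2. *)
have cross : \sum_j ((p j)^-1 - 1) * dot (A_ j *m a) (Y s j - Y [::] j)
    <= c * (tau^-1 * dot (x0 - a) (x0 - a)) + c * (tau^-1 * dot x0 x0)
     + c * yd + c * \sum_j W j * dot (Y [::] j - ys j) (Y [::] j - ys j).
  apply: le_trans (c_bound a (fun j => Y s j - Y [::] j)) _.
  have le1 : tau^-1 * dot a a <= 2 * (tau^-1 * dot (x0 - a) (x0 - a)) + 2 * (tau^-1 * dot x0 x0).
    rewrite !(mulrCA 2) -mulrDr ler_wpM2l ?invr_ge0 ?(ltW htau)//.
    by have := sqr_distD a x0 0; rewrite !subr0 -[dot (a - x0) _]dotNN opprB.
  have le2 : \sum_j W j * dot (Y s j - Y [::] j) (Y s j - Y [::] j)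
      <= 2 * yd + 2 * \sum_j W j * dot (Y [::] j - ys j) (Y [::] j - ys j).
    rewrite /yd !mulr_sumr -big_split /=; apply: ler_sum => j _.
    rewrite !(mulrCA 2) -mulrDr ler_wpM2l ?(ltW (W0 _))//.
    by rewrite -(dotNN (Y [::] j - _)) opprB sqr_distD.
  have := ler_wpM2l c_ge0 le1; have := ler_wpM2l c_ge0 le2; lra.
have gapsum : \sum_j ((p j)^-1 - 1) * (fr j (Y [::] j) - fr j (Y s j)
      + dot (A_ j *m a) (Y s j - Y [::] j))
    = \sum_j ((p j)^-1 - 1) * fr j (Y [::] j) - \sum_j ((p j)^-1 - 1) * fr j (Y s j)
      + \sum_j ((p j)^-1 - 1) * dot (A_ j *m a) (Y s j - Y [::] j).
  by rewrite -sumrB -big_split /=; apply: eq_bigr => j _; ring.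
have := ler_wpM2l c_ge0 stary; have := ler_wpM2l c1_ge0 stary.
move: gap; rewrite gapsum /kappa; lra.
Qed.

End Path.
End Tree.

(** * Means of real random variables *)

Section Expectation.
Context {R : realType} {dsp : measure_display} {Omega : measurableType dsp}.
Variable P : probability Omega R.

Definition has_mean (Z : Omega -> R) (r : R) : Prop :=
  P.-integrable setT (EFin \o Z) /\ (\int[P]_w (Z w)%:E = r%:E)%E.

Lemma has_mean_cst r : has_mean (cst r) r.
Proof.
split; first exact: finite_measure_integrable_cst.
have PT : P [set: Omega] = 1%E by exact: probability_setT.
rewrite (_ : (fun w => (cst r w)%:E) = cst r%:E)// integral_cst//.
by rewrite [X in (_ * X)%E]PT mule1.
Qed.

Lemma has_meanD Z1 Z2 r1 r2 :
  has_mean Z1 r1 -> has_mean Z2 r2 -> has_mean (fun w => Z1 w + Z2 w) (r1 + r2).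
Proof.
move=> [i1 e1] [i2 e2]; split; first exact: (integrableD measurableT i1 i2).
under eq_integral do rewrite EFinD.
by rewrite (integralD measurableT i1 i2) e1 e2.
Qed.

Lemma has_meanZ k Z r : has_mean Z r -> has_mean (fun w => k * Z w) (k * r).
Proof.
move=> [i e]; split; first exact: (integrableZl measurableT k i).
by under eq_integral do rewrite EFinM; rewrite (integralZl measurableT i) e.
Qed.

Lemma has_mean_sum (I : Type) (s : seq I) (Z : I -> Omega -> R) (r : I -> R) :
  (forall i, has_mean (Z i) (r i)) ->
  has_mean (fun w => \sum_(i <- s) Z i w) (\sum_(i <- s) r i).
Proof.
move=> h; elim: s => [|i s IH].
  by rewrite big_nil; under eq_fun do rewrite big_nil; exact: has_mean_cst.
by rewrite big_cons; under eq_fun do rewrite big_cons; exact: has_meanD.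
Qed.

Lemma has_mean_indic A : measurable A -> has_mean \1_A (fine (P A)).
Proof.
move=> mA; split; first exact: integrable_indic.
by rewrite integral_indic// setIT fineK// fin_num_measure.
Qed.

(* No measurability of [G] is required: the library's integral of a
   nonnegative function is a supremum over the simple functions below it. *)
Lemma integral_le_mean (G : Omega -> \bar R) Z r : has_mean Z r ->
  (forall w, (G w <= (Z w)%:E)%E) -> (\int[P]_w G w <= r%:E)%E.
Proof.
have nnle (f1 f2 : Omega -> \bar R) : (forall w, 0 <= f1 w)%E -> (forall w, f1 w <= f2 w)%E ->
    (\int[P]_w f1 w <= \int[P]_w f2 w)%E.
  move=> f1_ge0 f12; have f2_ge0 w : (0 <= f2 w)%E by exact: le_trans (f12 w).
  rewrite !ge0_integralTE//; apply: ereal_sup_le => _ [h hf1 <-].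
  by exists h => // w; apply: le_trans (hf1 w) (f12 w).
move=> [iZ eZ] GZ; rewrite -eZ integralE [leRHS]integralE.
apply: leeB; apply: nnle => w.
- exact: funepos_ge0.
- by apply: (@funepos_le _ _ setT) => [v _|]; [exact: GZ|rewrite inE].
- exact: funeneg_ge0.
- by apply: (@funeneg_le _ _ setT) => [v _|]; [exact: GZ|rewrite inE].
Qed.

End Expectation.

(** * Histories of draws and the vanishing mean of the martingale *)

Fixpoint history (n : nat) (Omega : Type) (idx : nat -> Omega -> 'I_n) (k : nat)
    (w : Omega) : seq 'I_n :=
  if k is k'.+1 then idx k w :: history idx k' w else [::].

Section Draws.
Context {R : realType} {dsp : measure_display} {Omega : measurableType dsp}.
Context {P : probability Omega R} {n : nat} {p : 'I_n -> R} {idx : nat -> Omega -> 'I_n}.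
Hypothesis hidx : random_draws P p idx.
Hypothesis hp : forall i, 0 < p i.

Local Notation history := (history idx).

Lemma history_rev k w : [seq idx l w | l <- iota 1 k] = rev (history k w).
Proof.
elim: k => // k IH.
have -> : iota 1 k.+1 = rcons (iota 1 k) k.+1 by rewrite -(addn1 k) iotaD -cats1 addnC.
by rewrite map_rcons IH /= rev_cons.
Qed.

Lemma size_history k w : size (history k w) = k.
Proof. by elim: k => //= k ->. Qed.

Lemma history_idx k w w' l :
  history k w = history k w' -> (0 < l <= k)%N -> idx l w = idx l w'.
Proof.
elim: k => [|k IH] /=; first by case: l.
case=> Ek Eh; rewrite [(l <= _)%N]leq_eqVlt andb_orr => /orP[/andP[_ /eqP -> //]|].
by move=> lk; exact: IH.
Qed.

Lemma history_consE k i s : [set w | history k.+1 w = i :: s]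
  = [set w | history k w = s] `&` [set w | idx k.+1 w = i].
Proof. by apply/seteqP; split => w /= => [[-> ->]//|[-> ->]]. Qed.

Lemma measurable_history k s : measurable [set w | history k w = s].
Proof.
elim: k s => [|k IH] [|i s].
- by rewrite [X in measurable X](_ : _ = setT)//; apply/seteqP; split.
- by rewrite [X in measurable X](_ : _ = set0)//; apply/seteqP; split.
- by rewrite [X in measurable X](_ : _ = set0)//; apply/seteqP; split.
- by rewrite history_consE; apply: measurableI => //; exact: (draws_measurable hidx).
Qed.

Lemma history_indep k i s :
  P ([set w | history k w = s] `&` [set w | idx k.+1 w = i])
  = (P [set w | history k w = s] * (p i)%:E)%E.
Proof.
(* [random_draws] lists the past oldest first, while [history] puts the latest draw first: hence the
   event given by [rev s]. *)
have := @draws_indep _ _ _ _ _ _ _ hidx k.+1 i [set rev s] isT; rewrite (draws_law hidx)//=.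
rewrite [X in P (X `&` _) = _](_ : _ = [set w | history k w = s]); last first.
  apply/seteqP; split => w /=; rewrite history_rev; last by move=> ->.
  by move/(can_inj revK).
rewrite [X in _ = (P X * _)%E](_ : _ = [set w | history k w = s])//.
apply/seteqP; split => w /=; rewrite history_rev; last by move=> ->.
by move/(can_inj revK).
Qed.

Lemma history_gt0 s : (0 < P [set w | history (size s) w = s])%E.
Proof.
elim: s => [|i s IH] /=.
  rewrite [X in P X](_ : _ = setT) ?probability_setT//.
  by apply/seteqP; split.
by rewrite history_consE history_indep mule_gt0 ?lte_fin.
Qed.

Lemma history_realized s : exists w, history (size s) w = s.
Proof.
have := history_gt0 s; set A := [set w | _] => A0.
have [A_eq0|/set0P[w Aw]] := eqVneq A set0; last by exists w.
by move: A0; rewrite A_eq0 measure0 ltxx.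
Qed.

(** Each increment is a finite combination of indicators of histories, alone or joined with the next
    draw; by independence the factor [p j] of the joint event cancels its coefficient [(p j)^-1]. *)
Lemma mean_acc_mart (alpha : seq 'I_n -> 'I_n -> R) k :
  has_mean P (fun w => acc (mart_incr p alpha) (history k w)) 0.
Proof.
elim: k => [|k IH] /=; first exact: has_mean_cst.
rewrite -[X in has_mean _ _ X]addr0; apply: has_meanD => //.
have -> : (fun w => mart_incr p alpha (history k w) (idx k.+1 w))
  = (fun w => \sum_j \sum_(s : k.-tuple 'I_n)
      alpha s j * (\1_[set w | history k w = s] w + (- (p j)^-1) *
      \1_([set w | history k w = s] `&` [set w | idx k.+1 w = j]) w)).
  apply/funext => w; apply: eq_bigr => j _.
  have hk : size (history k w) == k by rewrite size_history.
  rewrite (bigD1 (Tuple hk))//= big1 ?addr0; last first.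
    move=> s sh; have sw : history k w <> s by move=> E; case/eqP: sh; exact: val_inj.
    by rewrite !indicE !memNset ?mulr0 ?addr0 ?mulr0//= => -[].
  rewrite !indicE mulrC mem_set//; congr (_ * (_ + _)).
  rewrite mulNr mulrC; congr (- (_ * _)).
  have [ij|ij] := eqVneq; first by rewrite mem_set.
  by rewrite memNset// => -[_ /= E]; rewrite E eqxx in ij.
rewrite -[X in has_mean _ _ X](_ : \sum_(j < n) \sum_(s : k.-tuple 'I_n) alpha s j *
    (fine (P [set w | history k w = s]) + (- (p j)^-1) *
     fine (P ([set w | history k w = s] `&` [set w | idx k.+1 w = j]))) = 0); last first.
  rewrite big1// => j _; rewrite big1// => s _.
  rewrite history_indep fineM//; last by rewrite fin_num_measure//; exact: measurable_history.
  by rewrite /= mulNr mulrCA mulVf ?gt_eqF// mulr1 subrr mulr0.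
apply: has_mean_sum => j; apply: has_mean_sum => s; apply: has_meanZ; apply: has_meanD.
  by apply: has_mean_indic; exact: measurable_history.
apply/has_meanZ/has_mean_indic/measurableI; first exact: measurable_history.
exact: (draws_measurable hidx).
Qed.

End Draws.

(** * Bilinear estimates behind the constants of the bound *)

Section OperatorConstants.
Context {R : realType} {d n : nat} {m : 'I_n -> nat}.
Variables (A_ : forall i, 'M[R]_(m i, d)) (p sigma : 'I_n -> R) (tau : R).
Hypotheses (hp : forall i, 0 < p i) (hp1 : \sum_i p i = 1).
Hypotheses (htau : 0 < tau) (hsigma : forall i, 0 < sigma i).

Let A : 'M[R]_(\sum_i m i, d) := \mxcol_i A_ i.

Lemma prob_le1 j : p j <= 1.
Proof.
rewrite -hp1 (bigD1 j)//= lerDl; apply: sumr_ge0 => i _; exact: ltW.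
Qed.

Lemma pmin_le j : pmin p <= p j.
Proof. by rewrite /pmin; exact: bigmin_le_cond. Qed.

Lemma pmin_gt0 : 0 < pmin p.
Proof. by rewrite /pmin; apply: lt_bigmin => // i _. Qed.

Lemma trmx_mxcol_mul (v : 'cV[R]_(\sum_i m i)) :
  A^T *m v = \sum_j (A_ j)^T *m submxcol v j.
Proof. by rewrite -[v in LHS]submxcolK tr_mxcol mul_mxrow_mxcol. Qed.

Lemma submxcol_mxcol_mul j (x : 'cV[R]_d) : submxcol (A *m x) j = A_ j *m x.
Proof. by rewrite -submxcol_mul mxcolK. Qed.

Lemma dot_mxcol_mul (x : 'cV[R]_d) (v : 'cV[R]_(\sum_i m i)) :
  dot (A *m x) v = \sum_j dot (A_ j *m x) (submxcol v j).
Proof. by rewrite dot_submxcol; apply: eq_bigr => j _; rewrite submxcol_mxcol_mul. Qed.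

(** Scaling [x] by tau^(-1/2) and block [j] of [z] by (sigma_j p_j)^(-1/2) turns the left side into
    a bilinear form of the matrix whose norm is [c]. *)
Lemma cst_c_bound (x : 'cV[R]_d) (z : forall j, 'cV[R]_(m j)) :
  let c := cst_c A_ p sigma tau in
  \sum_j ((p j)^-1 - 1) * dot (A_ j *m x) (z j)
    <= c / 2 * (tau^-1 * dot x x)
       + c / 2 * \sum_j dual_weights p sigma j * dot (z j) (z j).
Proof.
rewrite /cst_c -/A; set B := _ *: _ => /=.
pose u := \mxcol_j (((Num.sqrt (sigma j))^-1 * (Num.sqrt (p j))^-1) *: z j).
have st0 : 0 < Num.sqrt tau by rewrite sqrtr_gt0.
have Bu : B *m u = Num.sqrt tau *: \sum_j (A_ j)^T *m (((p j)^-1 - 1) *: z j).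
  rewrite /B -scalemxAl -!mulmxA trmx_mxcol_mul; congr (_ *: _); apply: eq_bigr => j _.
  congr (_ *m _); rewrite mulmxBl mul1mx submxcolB !submxcol_blockdiag mxcolK !scalerA -scalerBl.
  by congr (_ *: _); field; rewrite !gt_eqF ?sqrtr_gt0.
have nu : enorm u ^+ 2 = \sum_j dual_weights p sigma j * dot (z j) (z j).
  rewrite enorm2 dot_submxcol; apply: eq_bigr => j _; rewrite mxcolK dotZl dotZr mulrA.
  congr (_ * _); rewrite /dual_weights -expr2 exprMn !exprVn !sqr_sqrtr//; exact: ltW.
have -> : \sum_j ((p j)^-1 - 1) * dot (A_ j *m x) (z j) = dot ((Num.sqrt tau)^-1 *: x) (B *m u).
  rewrite Bu dotZl dotZr mulrA mulVf ?gt_eqF// mul1r dot_sumr; apply: eq_bigr => j _.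
  by rewrite dot_mulmx -scalemxAr dotZr.
have -> : tau^-1 * dot x x = enorm ((Num.sqrt tau)^-1 *: x) ^+ 2.
  by rewrite enorm2 dotZl dotZr mulrA -expr2 exprVn sqr_sqrtr// ltW.
rewrite -nu; set v := _ *: x.
have := cauchy_schwarz v (B *m u); have := enorm_mulmx_le B u.
have := enorm_ge0 v; have := enorm_ge0 u; have := opnorm_ge0 B.
move: (enorm v) (enorm u) (enorm (B *m u)) (opnorm B) => r t q c c0 t0 r0 h1 h2.
apply: (le_trans h2); apply: (@le_trans _ _ (c * (r * t))).
  by rewrite mulrCA ler_wpM2l.
have := mulr_ge0 c0 (sqr_ge0 (r - t)); lra.
Qed.

Lemma cst_A_bound (x : 'cV[R]_d) (z : forall j, 'cV[R]_(m j)) :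
  let c1 := cst_c1 A_ p sigma tau in
  - (\sum_j ((p j)^-1 - 1) * dot (A_ j *m x) (z j))
    <= cst_A A_ sigma tau ^+ 2 / (2 * c1 * pmin p) * (tau^-1 * dot x x)
       + c1 / 2 * \sum_j dual_weights p sigma j * dot (z j) (z j).
Proof.
rewrite /=; set c1 := cst_c1 _ _ _ _; have st0 : 0 < Num.sqrt tau by rewrite sqrtr_gt0.
have c1_ge0 : 0 <= c1 by exact: opnorm_ge0.
have [c1_eq0|c1_neq0] := eqVneq c1 0.
  (* Division by zero gives 0, so the right side vanishes. So does the left: the matrix defining
     [c1] sends [u] to sqrt(tau) A^T (P^-1 - I) z, which is therefore 0. *)
  rewrite c1_eq0 mulr0 !mul0r invr0 mulr0 mul0r addr0 oppr_le0.
  pose u := \mxcol_j (((Num.sqrt (sigma j))^-1 * Num.sqrt (p j) * ((p j)^-1 - 1)) *: z j).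
  have /= := opnorm_eq0 u c1_eq0.
  rewrite -scalemxAl -!mulmxA -/A trmx_mxcol_mul => /eqP; rewrite scaler_eq0 gt_eqF//= => /eqP u0.
  suff -> : \sum_j ((p j)^-1 - 1) * dot (A_ j *m x) (z j) = 0 by [].
  have := congr1 (dot x) u0; rewrite dot0r dot_sumr => {2}<-.
  apply: eq_bigr => j _.
  rewrite !submxcol_blockdiag mxcolK !scalerA -dot_mulmx dotZr; congr (_ * _).
  by field; rewrite !gt_eqF ?sqrtr_gt0.
have c1_gt0 : 0 < c1 by rewrite lt_neqAle eq_sym c1_neq0.
have pm0 := pmin_gt0.
rewrite /cst_A -/A; set B := _ *m _.
pose v := \mxcol_j ((- ((p j)^-1 - 1) * (Num.sqrt (sigma j))^-1) *: z j).
pose xt := (Num.sqrt tau)^-1 *: x.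
have Bx j : submxcol (B *m xt) j = Num.sqrt (sigma j) *: (A_ j *m x).
  rewrite /B /xt -!mulmxA mul_scalar_mx scalerA mulfV ?gt_eqF// scale1r.
  by rewrite submxcol_blockdiag submxcol_mxcol_mul.
have -> : - (\sum_j ((p j)^-1 - 1) * dot (A_ j *m x) (z j)) = dot (B *m xt) v.
  rewrite dot_submxcol -sumrN; apply: eq_bigr => j _; rewrite Bx mxcolK dotZl dotZr.
  by field; rewrite !gt_eqF ?sqrtr_gt0.
have -> : tau^-1 * dot x x = enorm xt ^+ 2.
  by rewrite enorm2 dotZl dotZr mulrA -expr2 exprVn sqr_sqrtr// ltW.
(* Blockwise this is pmin (1 / p - 1)^2 <= 1 / p, which follows from pmin <= p <= 1. *)
have nv : pmin p * enorm v ^+ 2 <= \sum_j dual_weights p sigma j * dot (z j) (z j).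
  rewrite enorm2 dot_submxcol mulr_sumr; apply: ler_sum => j _.
  rewrite mxcolK dotZl dotZr !mulrA; apply: ler_wpM2r; first exact: dot_ge0.
  have -> : pmin p * (- ((p j)^-1 - 1)) / Num.sqrt (sigma j)
      * (- ((p j)^-1 - 1)) / Num.sqrt (sigma j)
     = pmin p * ((p j)^-1 - 1) ^+ 2 * (Num.sqrt (sigma j) ^+ 2)^-1.
    by field; rewrite !gt_eqF ?sqrtr_gt0.
  rewrite sqr_sqrtr ?(ltW (hsigma j))// /dual_weights mulrC; apply: ler_wpM2l.
    by rewrite invr_ge0 ltW.
  have q1 : 1 <= (p j)^-1 by rewrite invf_ge1// prob_le1.
  have : pmin p * (p j)^-1 <= 1 by rewrite ler_pdivrMr// mul1r pmin_le.
  have : 0 <= pmin p * (p j)^-1 by rewrite divr_ge0// ltW.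
  have pm0' := ltW pm0; nra.
have h1 := cauchy_schwarz (B *m xt) v; have h2 := enorm_mulmx_le B xt.
have v0 := enorm_ge0 v; apply: (le_trans h1).
apply: (@le_trans _ _ ((opnorm B * enorm xt) * enorm v)); first by rewrite ler_wpM2r.
(* This Young parameter makes the primal coefficient the one in [C_B], while [pmin p] is absorbed by
   [nv]. *)
have t0 : 0 < c1 * pmin p by rewrite mulr_gt0.
apply: (le_trans (young_mul _ _ t0)).
rewrite exprMn -mulrA [X in X + _]mulrAC -[2 * c1 * _]mulrA lerD2l.
rewrite mulrAC -!mulrA ler_pM2l// mulrC.
have := nv; have : 0 <= (2^-1 : R) by []; nra.
Qed.

End OperatorConstants.

(** Jensen's inequality for uniform averages, by induction: each new average is a convex combination
    of the old one and the new point. *)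
Lemma convex_efun_mean (R : realType) (N : nat) (h : 'cV[R]_N -> \bar R)
    (v : nat -> 'cV[R]_N) (K : nat) :
  (forall x, (-oo < h x)%E) -> convex_efun h -> (forall k, (h (v k) < +oo)%E) ->
  (h (K.+1%:R^-1 *: \sum_(k < K.+1) v k)%R
    <= (K.+1%:R^-1 * \sum_(k < K.+1) fine (h (v k)))%:E)%E.
Proof.
move=> hNy hc hv; elim: K => [|K IH].
  by rewrite !big_ord_recr !big_ord0 /= !add0r invr1 scale1r mul1r fineK// fin_real// hNy hv.
set S := \sum_(k < K.+1) v k in IH *.
have K0 : 0 < (K.+1%:R : R) by [].
have K2 : (K.+2%:R : R) = K.+1%:R + 1 by rewrite -natr1.
pose t : R := K.+1%:R / K.+2%:R.
have t01 : 0 < t < 1.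
  by rewrite divr_gt0//= ltr_pdivrMr// mul1r K2 ltrDl.
have t1 : 1 - t = K.+2%:R^-1.
  have k20 : K.+2%:R != 0 :> R by rewrite pnatr_eq0.
  by apply: (mulIf k20); rewrite mulrBl mul1r /t divfK// mulVf// K2 addrAC subrr add0r.
have tK : t / K.+1%:R = K.+2%:R^-1 by rewrite /t mulrAC mulfV ?mul1r// pnatr_eq0.
rewrite big_ord_recr [in leRHS]big_ord_recr /= -/S.
have -> : K.+2%:R^-1 *: (S + v K.+1) = t *: (K.+1%:R^-1 *: S) + (1 - t) *: v K.+1.
  by rewrite t1 scalerDr scalerA tK.
have hS : (h (K.+1%:R^-1 *: S)%R < +oo)%E by apply: (le_lt_trans IH); exact: ltry.
apply: le_trans (convex_efun_fine hNy hc t01 hS (hv _)) _.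
rewrite lee_fin mulrDr -t1; apply: lerD => //.
have : fine (h (K.+1%:R^-1 *: S)) <= K.+1%:R^-1 * \sum_(k < K.+1) fine (h (v k)).
  by rewrite -lee_fin fineK// fin_real// hNy hS.
case/andP: t01 => t0 _ /(ler_wpM2l (ltW t0)) /le_trans; apply.
by rewrite mulrA tK t1.
Qed.

(** * Determinism of the iterates and finiteness of the conjugates *)

Section Trajectories.
Context {R : realType} {d n : nat} {m : 'I_n -> nat}.
Variables (f : forall i, 'cV[R]_(m i) -> \bar R) (g : 'cV[R]_d -> \bar R).
Arguments f : clear implicits.
Variable A_ : forall i, 'M[R]_(m i, d).
Variables (p sigma : 'I_n -> R) (tau : R).
Hypotheses (hf : forall i, proper_lsc_convex (f i)) (hg : proper_lsc_convex g).
Hypotheses (htau : 0 < tau) (hsigma : forall i, 0 < sigma i).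

Let fs i := fenchel (f i).
Arguments fs : clear implicits.

Lemma fenchel_block_gtNy i b : (-oo < fs i b)%E.
Proof. by apply: fenchel_gtNy; case: (hf i). Qed.

Lemma fenchel_block_convex i : convex_efun (fs i).
Proof. by apply: fenchel_convex; case: (hf i). Qed.

(** Uniqueness of proximal points. The draw of index k comes after x^k and before x^(k+1), so the
    first k draws fix all iterates up to index k + 1. *)
Lemma spdhg_deterministic x0 y1 (idx idx' : nat -> 'I_n) x x' y y' ybar ybar' k :
  spdhg f g A_ p sigma tau x0 y1 idx x y ybar ->
  spdhg f g A_ p sigma tau x0 y1 idx' x' y' ybar' ->
  (forall l, (0 < l <= k)%N -> idx l = idx' l) ->
  [/\ x k = x' k, x k.+1 = x' k.+1, y k.+1 = y' k.+1 & ybar k.+1 = ybar' k.+1].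
Proof.
move=> S S'; have [[gNy gdom] _ gc] := hg.
have proxg := prox_unique htau gNy gc gdom.
elim: k => [|k IH] Eidx.
  have Ex0 : x 0%N = x' 0%N by rewrite (spdhg_x0 S) (spdhg_x0 S').
  have Ey : y 1%N = y' 1%N by rewrite (spdhg_y1 S) (spdhg_y1 S').
  have Eb : ybar 1%N = ybar' 1%N by rewrite (spdhg_ybar1 S) (spdhg_ybar1 S').
  split=> //; have := spdhg_x S' (ltn0Sn 0); rewrite -Eb /= -Ex0.
  exact: proxg (spdhg_x S (ltn0Sn 0)).
have [|_ Ex Ey Eb] := IH; first by move=> l /andP[l0 lk]; rewrite Eidx// l0 leqW.
have Ei : idx k.+1 = idx' k.+1 by apply: Eidx; rewrite leqnn.
have Ey2 : y k.+2 = y' k.+2.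
  rewrite -[LHS]submxcolK -[RHS]submxcolK; apply/eq_mxcolP => j.
  have [->|ji] := eqVneq j (idx k.+1); last first.
    by rewrite (spdhg_y_kept S)// (spdhg_y_kept S') -?Ei// Ey.
  have := spdhg_y_drawn S' (ltn0Sn k); rewrite -Ei -Ey -Ex.
  apply: prox_unique (spdhg_y_drawn S (ltn0Sn k)) => //.
  - exact: fenchel_block_gtNy.
  - exact: fenchel_block_convex.
  - exact: fenchel_dom.
have Eb2 : ybar k.+2 = ybar' k.+2 by rewrite (spdhg_ybar S)// (spdhg_ybar S')// Ey2 Ey.
split=> //; have := spdhg_x S' (ltn0Sn k.+1); rewrite -Eb2 /= -Ex.
exact: proxg (spdhg_x S (ltn0Sn k.+1)).
Qed.

(** Blocks with [p j = 1] have weight 0, and 0 times +oo is 0. *)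
Lemma wfenchel_fine y : (forall j, p j = 1 \/ (fs j (submxcol y j) < +oo)%E) ->
  wfenchel p f y = (\sum_j ((p j)^-1 - 1) * fine (fs j (submxcol y j)))%:E.
Proof.
move=> h; rewrite -sumEFin; apply: eq_bigr => j _.
have [->|fj] := h j; first by rewrite invr1 subrr mul0e mul0r.
by rewrite EFinM fineK// fin_real// fenchel_block_gtNy.
Qed.

Lemma wfenchel_eqy y j : (forall i, 0 < p i <= 1) -> p j <> 1 ->
  fs j (submxcol y j) = +oo%E -> wfenchel p f y = +oo%E.
Proof.
move=> p01 pj fj; have c0 i : 0 <= (p i)^-1 - 1.
  by have /andP[pi0 pi1] := p01 i; rewrite subr_ge0 invf_ge1.
have cj : 0 < (p j)^-1 - 1.
  rewrite lt_neqAle c0 andbT eq_sym subr_eq0; apply/eqP => E.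
  by apply: pj; rewrite -[LHS]invrK E invr1.
apply/eqP; rewrite esum_eqy.
  by apply/existsP; exists j; rewrite -/(fs j _) fj gt0_muley ?lte_fin.
move=> i _; rewrite -/(fs i _); have := fenchel_block_gtNy (submxcol y i).
case: (fs i _) => [r| |] //= _.
have := c0 i; rewrite le_eqVlt => /predU1P[<-|ci]; first by rewrite mul0e.
by rewrite gt0_muley ?lte_fin.
Qed.

(** * Blockwise inequalities at the saddle point *)

Section Saddle.
Let A : 'M[R]_(\sum_i m i, d) := \mxcol_i A_ i.
Variables (xs : 'cV[R]_d) (ys : 'cV[R]_(\sum_i m i)).
Hypothesis hsol : saddle_set (sepsum f) g A (xs, ys).

Lemma fenchel_sepsum_block y : fenchel (sepsum f) y = (\sum_i fs i (submxcol y i))%E.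
Proof. by apply: fenchel_sepsum => i; case: (hf i). Qed.

Lemma fenchel_sepsum_lty y : (fenchel (sepsum f) y < +oo)%E <->
  (forall j, (fs j (submxcol y j) < +oo)%E).
Proof.
rewrite fenchel_sepsum_block; split => [h j|h]; last by apply: lte_sum_pinfty => j _; exact: h.
rewrite ltey; apply: contraTneq h => fj; rewrite -leNgt leye_eq esum_eqy.
  by apply/existsP; exists j; rewrite fj.
by move=> i _; rewrite gt_eqF// fenchel_block_gtNy.
Qed.

Lemma saddle_primal_lty : (g xs < +oo)%E.
Proof.
have [[gNy [u gu]] _ _] := hg; have [/(_ u) h _] := hsol.
rewrite ltey; apply: contraTneq gu => gx; rewrite -leNgt.
by apply: le_trans h; rewrite gx addye.
Qed.

Lemma saddle_dual_lty j : (fs j (submxcol ys j) < +oo)%E.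
Proof.
suff /fenchel_sepsum_lty : (fenchel (sepsum f) ys < +oo)%E by exact.
pose v := \mxcol_i projT1 (cid (fenchel_dom (hf i))).
have fv : (fenchel (sepsum f) v < +oo)%E.
  by apply/fenchel_sepsum_lty => i; rewrite mxcolK; case: cid.
have [_ /(_ v) h] := hsol.
rewrite ltey; apply: contraTneq fv => fy; rewrite -leNgt.
by apply: le_trans h; rewrite fy addye.
Qed.

Lemma saddle_primal a : (g a < +oo)%E ->
  fine (g xs) - \sum_j dot (A_ j *m (a - xs)) (submxcol ys j) <= fine (g a).
Proof.
move=> ga; have [[gNy _] _ _] := hg; have [/(_ a) h _] := hsol.
move: h; rewrite -(@fineK _ (g xs)) ?fin_real ?gNy ?saddle_primal_lty//.
rewrite -(@fineK _ (g a)) ?fin_real ?gNy// -EFinD lee_fin /= dotNl => {}h.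
apply: le_trans h.
by rewrite lerD2l lerN2 (dotC _ (a - xs)) -dot_mxcol_mul dot_mulmx.
Qed.

(** The joint subgradient inequality, tested at a vector that differs from [ys] only in block
    [j]. *)
Lemma saddle_dual j b : (fs j b < +oo)%E ->
  fine (fs j (submxcol ys j)) + dot (A_ j *m xs) (b - submxcol ys j) <= fine (fs j b).
Proof.
move=> fb; have [_ h] := hsol.
pose v := \mxcol_i dfwith (fun i => submxcol ys i) j b i.
have ffin i (b' : 'cV[R]_(m i)) : (fs i b' < +oo)%E -> fs i b' = (fine (fs i b'))%:E.
  by move=> ?; rewrite fineK// fin_real// fenchel_block_gtNy.
have vfin i : (fs i (submxcol v i) < +oo)%E.
  by rewrite mxcolK; case: dfwithP => // i' _; exact: saddle_dual_lty.
move: (h v); rewrite /= !fenchel_sepsum_block.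
rewrite (eq_bigr _ (fun i _ => ffin i _ (saddle_dual_lty i))).
rewrite (eq_bigr _ (fun i _ => ffin i _ (vfin i))).
rewrite !sumEFin -EFinD lee_fin dot_mxcol_mul (bigD1 j)//= [X in _ + X](bigD1 j)//=.
rewrite [X in _ <= X](bigD1 j)//= submxcolB mxcolK dfwithin.
rewrite [X in _ + (_ + X)]big1 ?addr0; last first.
  by move=> i ij; rewrite submxcolB mxcolK dfwithout 1?eq_sym// subrr dot0r.
rewrite [X in _ <= _ + X](eq_bigr (fun i => fine (fs i (submxcol ys i)))); last first.
  by move=> i ij; rewrite mxcolK dfwithout 1?eq_sym.
by rewrite addrAC lerD2r.
Qed.

End Saddle.

End Trajectories.

(** * From the algorithm to the tree of histories, and back to the expected gap *)

Section Realization.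
Context {R : realType} {d n : nat} {m : 'I_n -> nat}.
Variables (A_ : forall i : 'I_n, 'M[R]_(m i, d)).
Variables (f : forall i : 'I_n, 'cV[R]_(m i) -> \bar R) (g : 'cV[R]_d -> \bar R).
Arguments f : clear implicits.
Hypotheses (hf : forall i, proper_lsc_convex (f i)) (hg : proper_lsc_convex g).
Variables (p sigma : 'I_n -> R) (tau gamma : R).
Hypotheses (hp : forall i, 0 < p i) (hp1 : \sum_i p i = 1).
Hypotheses (htau : 0 < tau) (hsigma : forall i, 0 < sigma i).
Hypothesis hgamma : 0 <= gamma < 1.
Hypothesis hstep : forall i,
  (p i)^-1 * tau * sigma i * opnorm (A_ i) ^+ 2 <= gamma ^+ 2.
Variables (dsp : measure_display) (Omega : measurableType dsp) (P : probability Omega R).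
Variable idx : nat -> Omega -> 'I_n.
Hypothesis hidx : random_draws P p idx.
Variables (x0 : 'cV[R]_d) (y1 : 'cV[R]_(\sum_i m i)).
Variables (x : nat -> Omega -> 'cV[R]_d) (y ybar : nat -> Omega -> 'cV[R]_(\sum_i m i)).
Hypothesis hiter : forall w, spdhg f g A_ p sigma tau x0 y1
  (idx ^~ w) (x ^~ w) (y ^~ w) (ybar ^~ w).
Variables (xs : 'cV[R]_d) (ys : 'cV[R]_(\sum_i m i)).
Hypothesis hsol : saddle_set (sepsum f) g (\mxcol_i A_ i) (xs, ys).

Let A : 'M[R]_(\sum_i m i, d) := \mxcol_i A_ i.
Let W := dual_weights p sigma.
Let fs i := fenchel (f i).
Arguments fs : clear implicits.
Let gr a : R := fine (g a).
Let fr j b : R := fine (fs j b).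
Arguments fr : clear implicits.

(* Every history has positive probability, so the iterates are functions of it. *)
Let wit s : Omega := projT1 (cid (history_realized hidx hp s)).

Let wit_history s : history idx (size s) (wit s) = s.
Proof. by rewrite /wit; case: cid. Qed.

Let X s : 'cV[R]_d := x (size s).+1 (wit s).
Let Y s j : 'cV[R]_(m j) := submxcol (y (size s).+1 (wit s)) j.

Let iter_history k w w' : history idx k w = history idx k w' ->
  [/\ x k w = x k w', x k.+1 w = x k.+1 w', y k.+1 w = y k.+1 w' & ybar k.+1 w = ybar k.+1 w'].
Proof.
move=> E; apply: (spdhg_deterministic hf hg htau hsigma (hiter w) (hiter w')) => l.
exact: history_idx E.
Qed.

Let X_history k w : X (history idx k w) = x k.+1 w.
Proof.
rewrite /X size_history; have [|_ -> //] := @iter_history k (wit (history idx k w)) w.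
by have := wit_history (history idx k w); rewrite size_history.
Qed.

Let Y_history k w j : Y (history idx k w) j = submxcol (y k.+1 w) j.
Proof.
rewrite /Y size_history; have [|_ _ -> //] := @iter_history k (wit (history idx k w)) w.
by have := wit_history (history idx k w); rewrite size_history.
Qed.

Let prev_wit i s : history idx (size s) (wit (i :: s)) = s /\ idx (size s).+1 (wit (i :: s)) = i.
Proof. by have := wit_history (i :: s); rewrite /= => -[]. Qed.

Let Y_prev i s j : Y s j = submxcol (y (size s).+1 (wit (i :: s))) j.
Proof. by rewrite -Y_history; have [-> _] := prev_wit i s. Qed.

Let X_prev i s : X s = x (size s).+1 (wit (i :: s)).
Proof. by rewrite -X_history; have [-> _] := prev_wit i s. Qed.

Let Y_kept s i j : j != i -> Y (i :: s) j = Y s j.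
Proof.
move=> ji; rewrite (Y_prev i s) /Y /=.
by apply: (spdhg_y_kept (hiter (wit (i :: s)))) => //; have [_ ->] := prev_wit i s.
Qed.

Let gNy a : (-oo < g a)%E. Proof. by case: hg => -[]. Qed.
Let gcvx : convex_efun g. Proof. by case: hg. Qed.
Let fsNy j b : (-oo < fs j b)%E. Proof. exact: fenchel_block_gtNy. Qed.

Let X_is_prox s : prox tau g
  (prevX X x0 s - tau *: \sum_j ((A_ j)^T *m (Y s j + (p j)^-1 *: incrY Y s j))) (X s).
Proof.
have H := hiter (wit s).
have -> : \sum_j ((A_ j)^T *m (Y s j + (p j)^-1 *: incrY Y s j))
    = A^T *m ybar (size s).+1 (wit s).
  rewrite trmx_mxcol_mul; apply: eq_bigr => j _; congr (_ *m _).
  (* At the empty history the extrapolated point is [y1] itself, in agreement with a zero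
     increment. *)
  case: s H => [|i s] H.
    by have /= -> := spdhg_ybar1 H; rewrite scaler0 addr0 /Y /=; have /= -> := spdhg_y1 H.
  have /= -> := spdhg_ybar H (ltn0Sn (size s)).
  by rewrite submxcolD submxcol_blockdiag submxcolB (Y_prev i s).
have -> : prevX X x0 s = x (size s) (wit s).
  by case: s H => [|i s] H /=; [have /= -> := spdhg_x0 H|rewrite (X_prev i)].
exact: (spdhg_x H (ltn0Sn (size s))).
Qed.

Let Y_is_prox s j : prox (sigma j) (fs j) (Y s j + sigma j *: (A_ j *m X s)) (Y (j :: s) j).
Proof.
have [_ Ej] := prev_wit j s.
have := spdhg_y_drawn (hiter (wit (j :: s))) (ltn0Sn (size s)).
by rewrite Ej (Y_prev j s) (X_prev j s).
Qed.

Let X_lty s : (g (X s) < +oo)%E.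
Proof. by case: hg => -[_ [u gu]] _ _; exact: (@prox_ltey _ _ _ _ _ _ u (X_is_prox s) gu). Qed.

Let virtY_lty s j : (fs j (Y (j :: s) j) < +oo)%E.
Proof.
have [u fu] := fenchel_dom (hf j).
exact: (@prox_ltey _ _ _ _ _ _ u (@Y_is_prox s j) fu).
Qed.

Hypothesis y1_lty : forall j, p j = 1 \/ (fs j (submxcol y1 j) < +oo)%E.

Let Y_nil j : Y [::] j = submxcol y1 j.
Proof. by rewrite /Y /=; have /= -> := spdhg_y1 (hiter (wit [::])). Qed.

Let Y_lty s j : p j = 1 \/ (fs j (Y s j) < +oo)%E.
Proof.
elim: s => [|i s IH]; first by rewrite Y_nil.
have [->|ji] := eqVneq j i; first by right; exact: virtY_lty.
by rewrite Y_kept.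
Qed.

(** A drawn block is a proximal point, hence in the domain. A block with [p j = 1] must be the drawn
    one, since a second index of positive probability would push the sum above 1. *)
Let drawn_lty w k j : (fs j (submxcol (y k.+2 w) j) < +oo)%E.
Proof.
have [->|jk] := eqVneq j (idx k.+1 w).
  have := virtY_lty (history idx k w) (idx k.+1 w).
  by rewrite -[_ :: _]/(history idx k.+1 w) Y_history.
have [pj1|] := Y_lty (history idx k.+1 w) j; last by rewrite Y_history.
have : 0 < \sum_(i | i != j) p i.
  rewrite (bigD1 (idx k.+1 w)) 1?eq_sym//=.
  by rewrite ltr_pwDl// sumr_ge0// => i _; exact: ltW.
move: hp1; rewrite (bigD1 j)//= pj1 => /eqP.
by rewrite -subr_eq0 addrAC subrr add0r => /eqP ->; rewrite ltxx.
Qed.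

Let c := cst_c A_ p sigma tau.
Let c1 := cst_c1 A_ p sigma tau.
Let ysb j := submxcol ys j.
Let kappa := 1 / (1 - gamma) + 2 * c + c1.
Let alpha := alpha_path A_ p sigma gamma X Y fr xs ysb c c1.
Let Fsum (v : 'cV[R]_(\sum_i m i)) : R := \sum_j fr j (submxcol v j).

Let wnorm2E (v : 'cV[R]_(\sum_i m i)) :
  wnorm2 W v = \sum_j W j * dot (submxcol v j) (submxcol v j).
Proof. by apply: eq_bigr => j _; rewrite enorm2. Qed.

Let fenchel_fine v : (forall j, (fs j (submxcol v j) < +oo)%E) ->
  fenchel (sepsum f) v = (Fsum v)%:E.
Proof.
move=> fv; rewrite fenchel_sepsum_block// /Fsum -sumEFin; apply: eq_bigr => j _.
by rewrite fineK// fin_real// fsNy fv.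
Qed.

Let path_gap a (b : 'cV[R]_(\sum_i m i)) s : (g a < +oo)%E ->
  (forall j, (fs j (submxcol b j) < +oo)%E) ->
  acc (gap_incr A_ X Y gr fr a (fun j => submxcol b j)) s
  <= (1 + 2 * c) / 2 * xnorm2 tau (x0 - a) + wnorm2 W (y1 - b)
     + (\sum_j ((p j)^-1 - 1) * fr j (submxcol y1 j) - \sum_j ((p j)^-1 - 1) * fr j (ysb j))
     + (kappa * V1 p sigma tau (x0 - xs) (y1 - ys) + c * xnorm2 tau x0
        + c * wnorm2 W (y1 - ys)
        + cst_A A_ sigma tau ^+ 2 / (2 * c1 * pmin p) * xnorm2 tau xs)
     + acc (mart_incr p alpha) s.
Proof.
move=> ga fb; rewrite /V1 -/W !wnorm2E /xnorm2 !enorm2.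
pose i0 := idx 0%N (wit [::]).
have c_ge0 : 0 <= c by exact: opnorm_ge0.
have c1_ge0 : 0 <= c1 by exact: opnorm_ge0.
have Yb (v : 'cV[R]_(\sum_i m i)) j : submxcol (y1 - v) j = Y [::] j - submxcol v j.
  by rewrite submxcolB Y_nil.
under [X in _ + X + _ + _ + _]eq_bigr do rewrite Yb.
under [X in _ + _ + (X - _) + _ + _]eq_bigr do rewrite -Y_nil.
rewrite (eq_bigr (fun j => W j * dot (Y [::] j - submxcol ys j) (Y [::] j - submxcol ys j))
  (fun j _ => congr2 (fun u v => W j * dot u v) (Yb ys j) (Yb ys j))).
apply: (path_bound hp htau hsigma hgamma hstep (x0 := x0)
  (Gd := [set a | (g a < +oo)%E]) (Fd := fun j => [set b | (fs j b < +oo)%E])) => //.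
- by move=> s' a' ga'; exact: (prox_three_point htau gNy gcvx (X_is_prox s') ga').
- move=> s' j b' fb'; exact: (prox_three_point (hsigma j) (fsNy (j := j))
    (fenchel_block_convex hf (i := j)) (@Y_is_prox s' j) fb').
- exact: (saddle_primal_lty hg hsol).
- by move=> j; exact: (saddle_dual_lty hf hsol j).
- by move=> a' ga'; exact: (saddle_primal hg hsol ga').
- by move=> j b' fb'; exact: (saddle_dual hf hsol fb').
- exact: prob_le1.
- by move=> a' z; exact: cst_c_bound.
- by move=> z; exact: cst_A_bound.
Qed.

Let acc_history (V : zmodType) (psi : seq 'I_n -> 'I_n -> V) K w :
  acc psi (history idx K w) = \sum_(k < K) psi (history idx k w) (idx k.+1 w).
Proof. by elim: K => [|K IH]; rewrite ?big_ord0// big_ord_recr /= IH. Qed.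

(** The number of iterations is [K.+1]. *)
Variable K : nat.
Let xav w : 'cV[R]_d := K.+1%:R^-1 *: \sum_(1 <= k < K.+2) x k w.
Let yav w : 'cV[R]_(\sum_i m i) := K.+1%:R^-1 *: \sum_(1 <= k < K.+2) y k.+1 w.

(** The gap is convex in the averaged pair: Jensen's inequality handles g and the conjugate, and the
    bilinear terms average exactly. *)
Let Hgap_le w a b : (g a < +oo)%E -> (fenchel (sepsum f) b < +oo)%E ->
  (Hgap (sepsum f) g A (xav w, yav w) (a, b)
   <= (K.+1%:R^-1 * acc (gap_incr A_ X Y gr fr a (fun j => submxcol b j))
                        (history idx K.+1 w))%:E)%E.
Proof.
move=> ga fb; have K0 : K.+1%:R != 0 :> R by rewrite pnatr_eq0.
have fbj : forall j, (fs j (submxcol b j) < +oo)%E by apply/(fenchel_sepsum_lty hf).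
rewrite acc_history /Hgap /= ga fb /=.
pose v k := x k.+1 w; pose u k := y k.+2 w.
have xE : xav w = K.+1%:R^-1 *: \sum_(k < K.+1) v k by rewrite /xav big_add1 big_mkord.
have yE : yav w = K.+1%:R^-1 *: \sum_(k < K.+1) u k by rewrite /yav big_add1 big_mkord.
have gv k : (g (v k) < +oo)%E by rewrite /v -X_history X_lty.
have fuj k j : (fs j (submxcol (u k) j) < +oo)%E by exact: drawn_lty.
have fu k : (fenchel (sepsum f) (u k) < +oo)%E by apply/(fenchel_sepsum_lty hf) => j; exact: fuj.
have pf : proper_fun (sepsum f) by apply: proper_sepsum => i; case: (hf i).
have FNy z : (-oo < fenchel (sepsum f) z)%E by exact: fenchel_gtNy.
have gx := convex_efun_mean K gNy gcvx gv.
have Fy := convex_efun_mean K FNy (fenchel_convex pf) fu.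
move: gx Fy; rewrite -xE -yE.
have Fu k : fine (fenchel (sepsum f) (u k)) = Fsum (u k) by rewrite fenchel_fine.
under [X in _ -> (_ <= (_ * X)%:E)%E -> _]eq_bigr do rewrite Fu.
move=> gx Fy.
have gxE : g (xav w) = (gr (xav w))%:E.
  by rewrite fineK// fin_real// gNy (le_lt_trans gx)// ltry.
have FyE : fenchel (sepsum f) (yav w) = (fine (fenchel (sepsum f) (yav w)))%:E.
  by rewrite fineK// fin_real// FNy (le_lt_trans Fy)// ltry.
move: gx Fy; rewrite FyE gxE (fenchel_fine fbj).
rewrite -[g a](@fineK _ _) ?fin_real ?gNy//= !lee_fin => gx Fy.
have gapE k : gap_incr A_ X Y gr fr a (fun j => submxcol b j) (history idx k w) (idx k.+1 w)
    = gr (v k) + Fsum (u k) + dot (A *m v k) b - dot (A *m a) (u k) - (fine (g a) + Fsum b).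
  rewrite /gap_incr X_history !dot_mxcol_mul /Fsum.
  rewrite (eq_bigr (fun j => fr j (submxcol (u k) j) - fr j (submxcol b j)
    + dot (A_ j *m v k) (submxcol b j) - dot (A_ j *m a) (submxcol (u k) j))); last first.
    by move=> j _; rewrite -[_ :: _]/(history idx k.+1 w) Y_history.
  by rewrite !big_split /= !sumrN /gr; ring.
rewrite (eq_bigr _ (fun (k : 'I_K.+1) _ => gapE k)) big_split /=.
rewrite sumr_const card_ord -[(- _) *+ _]mulr_natl mulrDr mulKf//.
rewrite !big_split /= sumrN !mulrDr mulrN.
have -> : dot (A *m xav w) b = K.+1%:R^-1 * \sum_(k < K.+1) dot (A *m v k) b.
  by rewrite xE -scalemxAr dotZl mulmx_sumr dot_suml.
have -> : dot (A *m a) (yav w) = K.+1%:R^-1 * \sum_(k < K.+1) dot (A *m a) (u k).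
  by rewrite yE dotZr dot_sumr.
have {}gx : gr (xav w) <= K.+1%:R^-1 * \sum_(k < K.+1) gr (v k) by [].
move: gx Fy; move: (K.+1%:R^-1) => q; lra.
Qed.

(** The martingale in [path_gap] does not depend on the comparison point, so constant plus
    martingale dominates the supremum pointwise; its mean is the constant. *)
Lemma restricted_gap_mean (Bx : set 'cV[R]_d) (By : set 'cV[R]_(\sum_i m i)) (sx sy : R) :
  (forall a, Bx a -> xnorm2 tau (x0 - a) <= sx) ->
  (forall b, By b -> wnorm2 W (y1 - b) <= sy) ->
  (\int[P]_w restricted_gap (sepsum f) g A (Bx `*` By) (xav w, yav w)
   <= (K.+1%:R^-1 * ((1 + 2 * c) / 2 * sx + sy
     + (\sum_j ((p j)^-1 - 1) * fr j (submxcol y1 j) - \sum_j ((p j)^-1 - 1) * fr j (ysb j))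
     + (kappa * V1 p sigma tau (x0 - xs) (y1 - ys) + c * xnorm2 tau x0
        + c * wnorm2 W (y1 - ys)
        + cst_A A_ sigma tau ^+ 2 / (2 * c1 * pmin p) * xnorm2 tau xs)))%:E)%E.
Proof.
move=> hx hy; set C := (X in _ * X).
rewrite -[C]addr0; apply: (integral_le_mean (Z := fun w => K.+1%:R^-1 *
  (C + acc (mart_incr p alpha) (history idx K.+1 w)))).
  apply: has_meanZ; apply: has_meanD; first exact: has_mean_cst.
  exact: (mean_acc_mart hidx).
move=> w; apply: ge_ereal_sup => _ [[a b] [/= Ba Bb] <-].
have [/andP[ga fb]|] := boolP ((g a < +oo)%E && (fenchel (sepsum f) b < +oo)%E); last first.
  by rewrite /Hgap /= => /negbTE ->; rewrite leNye.
apply: (le_trans (Hgap_le w ga fb)); rewrite lee_fin ler_wpM2l ?invr_ge0//.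
have fbj : forall j, (fs j (submxcol b j) < +oo)%E by apply/(fenchel_sepsum_lty hf).
apply: (le_trans (path_gap (history idx K.+1 w) ga fbj)); rewrite lerD2r /C !lerD2r.
apply: lerD; last exact: hy.
rewrite ler_wpM2l ?hx// divr_ge0// addr_ge0// mulr_ge0//; exact: opnorm_ge0.
Qed.

End Realization.

Theorem theorem4p9 (R : realType) (d n : nat) (m : 'I_n -> nat)
  (A_ : forall i : 'I_n, 'M[R]_(m i, d))
  (f : forall i : 'I_n, 'cV[R]_(m i) -> \bar R) (g : 'cV[R]_d -> \bar R)
  (hf : forall i, proper_lsc_convex (f i)) (hg : proper_lsc_convex g)
  (hmin : exists x, forall u,
    (objective (sepsum f) g (\mxcol_i A_ i) x
     <= objective (sepsum f) g (\mxcol_i A_ i) u)%E)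
  (hri : qualification (sepsum f) g (\mxcol_i A_ i))
  (p sigma : 'I_n -> R) (tau gamma : R)
  (hp : forall i, 0 < p i) (hp1 : \sum_i p i = 1)
  (htau : 0 < tau) (hsigma : forall i, 0 < sigma i)
  (hgamma : 0 <= gamma < 1)
  (hstep : forall i,
    (p i)^-1 * tau * sigma i * opnorm (A_ i) ^+ 2 <= gamma ^+ 2)
  (dsp : measure_display) (Omega : measurableType dsp) (P : probability Omega R)
  (idx : nat -> Omega -> 'I_n) (hidx : random_draws P p idx)
  (x0 : 'cV[R]_d) (y1 : 'cV[R]_(\sum_i m i))
  (x : nat -> Omega -> 'cV[R]_d) (y ybar : nat -> Omega -> 'cV[R]_(\sum_i m i))
  (hiter : forall w, spdhg f g A_ p sigma tau x0 y1
             (idx ^~ w) (x ^~ w) (y ^~ w) (ybar ^~ w))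
  (xs : 'cV[R]_d) (ys : 'cV[R]_(\sum_i m i))
  (hsol : saddle_set (sepsum f) g (\mxcol_i A_ i) (xs, ys))
  (Bx : set 'cV[R]_d) (By : set 'cV[R]_(\sum_i m i))
  (K : nat) (hK : (0 < K)%N) :
  let xav w := K%:R^-1 *: \sum_(1 <= k < K.+1) x k w in
  let yav w := K%:R^-1 *: \sum_(1 <= k < K.+1) y k.+1 w in
  (\int[P]_w restricted_gap (sepsum f) g (\mxcol_i A_ i) (Bx `*` By)
               (xav w, yav w)
   <= C_B f A_ p sigma tau gamma Bx By x0 xs y1 ys * (K%:R^-1)%:E)%E.
Proof.
case: K hK => // K' _ /=.
set c := cst_c A_ p sigma tau; set W := dual_weights p sigma.
have p01 i : 0 < p i <= 1 by rewrite hp prob_le1.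
have coef_gt0 : 0 < (1 + 2 * c) / 2.
  have : 0 <= c by exact: opnorm_ge0.
  lra.
have Kinv_gt0 : 0 < K'.+1%:R^-1 :> R by rewrite invr_gt0.
(* For an empty set the gap is identically -oo. Otherwise both suprema in [C_B] exceed -oo, so no
   opposite infinities meet below. *)
have [B0|/set0P[[a0 b0] [/= Ba0 Bb0]]] := eqVneq (Bx `*` By) set0.
  rewrite (eq_integral (cst -oo%E)); last first.
    by move=> w _; rewrite /restricted_gap B0 image_set0 ereal_sup0.
  have PT : P [set: Omega] = 1%E by exact: probability_setT.
  by rewrite integral_cst// [X in (_ * X)%E]PT mule1 leNye.
set SX := ereal_sup [set (xnorm2 tau (x0 - a)%R)%:E | a in Bx].
set SY := ereal_sup [set (wnorm2 W (y1 - b)%R)%:E | b in By].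
have SXge a : Bx a -> ((xnorm2 tau (x0 - a))%:E <= SX)%E.
  by move=> Ba; apply: ereal_sup_ubound; exists a.
have SYge b : By b -> ((wnorm2 W (y1 - b))%:E <= SY)%E.
  by move=> Bb; apply: ereal_sup_ubound; exists b.
have SXNy : (-oo < SX)%E by apply: lt_le_trans (SXge _ Ba0); exact: ltNyr.
have SYNy : (-oo < SY)%E by apply: lt_le_trans (SYge _ Bb0); exact: ltNyr.
have ys_lty j : (fenchel (f j) (submxcol ys j) < +oo)%E.
  exact: (saddle_dual_lty hf hsol j).
have wys : wfenchel p f ys = (\sum_j ((p j)^-1 - 1) * fine (fenchel (f j) (submxcol ys j)))%:E.
  by apply: (wfenchel_fine hf) => j; right.
rewrite /C_B -/c -/W -/SX -/SY wys.
(* If a block with [p j <> 1] starts outside the domain of its conjugate, [C_B] is +oo and the bound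
   is trivial. *)
have [y1_lty|/existsNP[j /not_orP[pj /negP]]] :=
    pselect (forall j, p j = 1 \/ (fenchel (f j) (submxcol y1 j) < +oo)%E); last first.
  rewrite -leNgt leye_eq => /eqP fj; rewrite (wfenchel_eqy hf p01 pj fj).
  case: SX SXNy {SXge} => [sx| |] // _; case: SY SYNy {SYge} => [sy| |] // _;
    by rewrite ?gt0_muley ?lte_fin//= gt0_mulye ?lte_fin// leey.
rewrite (wfenchel_fine hf y1_lty).
(* An infinite supremum over [Bx] or [By] likewise makes [C_B] equal to +oo. *)
case: SX SXNy SXge => [sx| |] // _ SXge; last first.
  case: SY SYNy {SYge} => [sy| |] // _;
    by rewrite gt0_muley ?lte_fin//= gt0_mulye ?lte_fin// leey.
case: SY SYNy SYge => [sy| |] // _ SYge; last by rewrite /= gt0_mulye ?lte_fin// leey.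
apply: (le_trans (restricted_gap_mean hf hg hp hp1 htau hsigma hgamma hstep hidx hiter hsol
  y1_lty K' (Bx := Bx) (By := By) (sx := sx) (sy := sy) _ _)).
- by move=> a /SXge; rewrite lee_fin.
- by move=> b /SYge; rewrite lee_fin.
- rewrite -!(EFinM, EFinD) -/c -/W lee_fin le_eqVlt; apply/orP; left; apply/eqP; ring.
Qed.
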